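(* Let $\Omega \subset \mathbb{R}^d$, $d \in \mathbb{N}$, be a nonempty open bounded set, let $\alpha \in (0,1)$, let $J\colon H_0^1(\Omega)\times L^2(\Omega)\to\mathbb{R}$ be Fr\'echet differentiable, and let $U_{\mathrm{ad}}\subset L^2(\Omega)$ be nonempty and convex. Let $\bar u \in L^2(\Omega)$ be a control with associated state $\bar y := S(\bar u)$. Then $\bar u$ satisfies the Bouligand stationarity condition \[ \bar u \in U_{\mathrm{ad}}, \quad \langle \partial_y J(\bar y,\bar u), S'(\bar u)(u-\bar u)\rangle_{H_0^1(\Omega)} + (\partial_u J(\bar y,\bar u), u-\bar u)_{L^2(\Omega)} \geq 0 \quad \forall u \in U_{\mathrm{ad}} \] if and only if there exists an adjoint state $\bar p$ such that the following KKT-system holds: \[ \begin{gathered} \bar u \in U_{\mathrm{ad}}, \qquad \bar y \in H_0^1(\Omega), \qquad \bar p \in V_{\bar y},\\ -\Delta\bar y + \operatorname{sgn}(\bar y)|\bar y|^{\alpha} = \bar u \text{ in } \Omega, \quad \bar y = 0 \text{ on } \partial\Omega,\\ (\bar p, z)_{H_0^1(\Omega)} + \alpha\int_{\{\bar y\neq 0\}} \frac{\bar p z}{|\bar y|^{1-\alpha}}\,\mathrm{d}x = \langle \partial_y J(\bar y,\bar u), z\rangle_{H_0^1(\Omega)} \quad \forall z \in V_{\bar y},\\ (\bar p + \partial_u J(\bar y,\bar u), u - \bar u)_{L^2(\Omega)} \geq 0 \quad \forall u \in U_{\mathrm{ad}}. \end{gathered} \] Here, the PDE for $\bar y$ is understood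 in the weak sense and \[ V_{\bar y} := \Big\{ v \in H_0^1(\Omega) \colon \int_{\{\bar y\neq 0\}} \frac{v^2}{|\bar y|^{1-\alpha}}\,\mathrm{d}x < \infty \text{ and } v = 0 \text{ a.e. in } \{\bar y = 0\}\Big\}. \]
   Context: $H_0^1(\Omega)$ is the closure of $C_c^\infty(\Omega)$ in $H^1(\Omega)$, equipped with the inner product $(v,w)_{H_0^1(\Omega)} := \int_\Omega \nabla v\cdot\nabla w\,\mathrm{d}x$; $H^{-1}(\Omega)$ is its topological dual, with dual pairing $\langle\cdot,\cdot\rangle_{H_0^1(\Omega)}$, and $L^2(\Omega)\cong L^2(\Omega)^*\hookrightarrow H^{-1}(\Omega)$. For every $u \in H^{-1}(\Omega)$ there is a unique weak solution $y =: S(u)\in H_0^1(\Omega)$ of $-\Delta y + \operatorname{sgn}(y)|y|^\alpha = u$ in $\Omega$, $y=0$ on $\partial\Omega$, i.e., a unique $y \in H_0^1(\Omega)$ with $\int_\Omega \nabla y\cdot\nabla v + \operatorname{sgn}(y)|y|^\alpha v\,\mathrm{d}x = \langle u,v\rangle_{H_0^1(\Omega)}$ for all $v \in H_0^1(\Omega)$. The map $S\colon L^2(\Omega)\to H_0^1(\Omega)$ is Fr\'echet differentiable, with derivative $S'(u)\in\mathcal{L}(L^2(\Omega),H_0^1(\Omega))$ given as follows: with $y=S(u)$ and $h\in L^2(\Omega)$, $\delta = S'(u)h$ is the unique element of $V_y$ (defined as $V_{\bar y}$ with $\bar y$ replaced by $y$) with $(\delta,z)_{H_0^1(\Omega)}+\alpha\int_{\{y\ne0\}}\frac{\delta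 z}{|y|^{1-\alpha}}\,\mathrm{d}x=\langle h,z\rangle_{H_0^1(\Omega)}$ for all $z\in V_y$. $\partial_y J(\bar y,\bar u)\in H^{-1}(\Omega)$ and $\partial_u J(\bar y,\bar u)\in L^2(\Omega)\cong L^2(\Omega)^*$ denote the partial Fr\'echet derivatives of $J$ with respect to its first and second argument at $(\bar y,\bar u)$. *)

(* Defs.v *)
From HB Require Import structures.
From mathcomp Require Import all_boot all_order all_algebra.
From mathcomp Require Import generic_quotient ring_quotient.
From mathcomp Require Import all_classical all_reals all_analysis.
From mathcomp Require Import measurable_realfun ring lra.

Set Implicit Arguments.
Unset Strict Implicit.
Unset Printing Implicit Defensive.
Import Order.TTheory GRing.Theory Num.Theory.
Import numFieldNormedType.Exports.
Local Open Scope classical_set_scope.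
Local Open Scope ring_scope.

Record semidot (R : realType) (V : lmodType R) := Semidot {
  dot :> V -> V -> R;
  dotC : forall x y, dot x y = dot y x;
  dotDl : forall a x y z, dot (a *: x + y) z = a * dot x z + dot y z;
  dot_ge0 : forall x, 0 <= dot x x }.

Section semidot_quotient.
Context (R : realType) (V : lmodType R) (q : semidot V).
Local Open Scope quotient_scope.

Let dot0l y : q 0 y = 0.
Proof.
have := dotDl q 1 0 0 y; rewrite scale1r addr0 mul1r => /eqP.
by rewrite -subr_eq subrr eq_sym => /eqP.
Qed.

Let dotZl a x z : q (a *: x) z = a * q x z.
Proof. by rewrite -[a *: x]addr0 dotDl dot0l addr0. Qed.

Let dotAl x y z : q (x + y) z = q x z + q y z.
Proof. by rewrite -[x]scale1r dotDl scale1r mul1r. Qed.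

Let dotZr a x z : q z (a *: x) = a * q z x.
Proof. by rewrite dotC dotZl dotC. Qed.

Let dotAr x y z : q z (x + y) = q z x + q z y.
Proof. by rewrite dotC dotAl !(dotC q z). Qed.

Let dot_quad t x y : 0 <= q x x + 2 * t * q x y + t ^+ 2 * q y y.
Proof.
have := dot_ge0 q (x + t *: y).
rewrite !(dotAl, dotAr) !(dotZl, dotZr) (dotC q y x).
by congr (_ <= _); ring.
Qed.

Lemma dot_CauchySchwarz x y : q x y ^+ 2 <= q x x * q y y.
Proof.
have := dot_ge0 q y; rewrite le_eqVlt => /predU1P[y0|y0].
  rewrite -y0 mulr0; have [->|b0] := eqVneq (q x y) 0; first by rewrite expr0n.
  have := dot_quad (- (q x x + 1) / (2 * q x y)) x y; rewrite -y0 mulr0 addr0.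
  have -> : q x x + 2 * (- (q x x + 1) / (2 * q x y)) * q x y = - 1.
    by field.
  by rewrite oppr_ge0 ler10.
have := dot_quad (- q x y / q y y) x y.
rewrite -(pmulr_lge0 _ y0).
have -> : (q x x + 2 * (- q x y / q y y) * q x y + (- q x y / q y y) ^+ 2 * q y y) * q y y
  = q x x * q y y - q x y ^+ 2 by field; rewrite gt_eqF.
by rewrite subr_ge0.
Qed.

Definition seminorm (x : V) : R := Num.sqrt (q x x).
Local Notation p := seminorm.

Lemma seminormZ a x : p (a *: x) = `|a| * p x.
Proof.
by rewrite /p dotZl dotZr mulrA -expr2 sqrtrM ?sqr_ge0// sqrtr_sqr.
Qed.

Lemma seminormD x y : p (x + y) <= p x + p y.
Proof.
have pp : 0 <= p x + p y by rewrite addr_ge0 ?sqrtr_ge0.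
rewrite -(ger0_norm pp) -sqrtr_sqr ler_wsqrtr// sqrrD !sqr_sqrtr ?dot_ge0//.
rewrite !(dotAl, dotAr) (dotC q y x).
have : q x y <= p x * p y.
  rewrite (le_trans (ler_norm _))// -sqrtr_sqr -sqrtrM ?dot_ge0//.
  by rewrite ler_wsqrtr// dot_CauchySchwarz.
lra.
Qed.

Lemma seminorm0 : p 0 = 0.
Proof. by rewrite -(scale0r 0) seminormZ normr0 mul0r. Qed.

Lemma seminormN x : p (- x) = p x.
Proof. by rewrite -scaleN1r seminormZ normrN1 mul1r. Qed.

Lemma seminorm_ge0 x : 0 <= p x.
Proof. exact: sqrtr_ge0. Qed.

Definition snull : {pred V} := [pred x | p x == 0].

Lemma snull_zmod_closed : zmod_closed snull.
Proof.
split=> [|x y]; rewrite !inE ?seminorm0// => /eqP x0 /eqP y0.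
rewrite eq_le seminorm_ge0 andbT (le_trans (seminormD _ _))//.
by rewrite seminormN x0 y0 addr0.
Qed.

HB.instance Definition _ := GRing.isZmodClosed.Build V snull snull_zmod_closed.

(* The quotient of V by the vectors of zero seminorm: for V = preL2 below this
   identifies the functions that are equal a.e. *)
Definition squot : Type := Quotient.quot snull.

HB.instance Definition _ := GRing.Zmodule.on squot.
HB.instance Definition _ := EqQuotient.on squot.

Definition spi (x : V) : squot := \pi_squot x.

Lemma spi_eqP x y : reflect (p (x - y) = 0) (spi x == spi y).
Proof. by rewrite /spi -Quotient.idealrBE inE; exact: eqP. Qed.

Lemma spiD x y : spi (x + y) = spi x + spi y.
Proof. exact: (@Quotient.pi_add _ snull). Qed.

Lemma spi_repr (x : squot) : spi (repr x) = x.
Proof. exact: reprK. Qed.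

Definition sscale (a : R) (x : squot) : squot := spi (a *: repr x).

Lemma spiZ a x : spi (a *: x) = sscale a (spi x).
Proof.
apply/eqP/spi_eqP; rewrite -scalerBr seminormZ.
by have /eqP/spi_eqP -> := esym (spi_repr (spi x)); rewrite mulr0.
Qed.

Let sscaleA a b v : sscale a (sscale b v) = sscale (a * b) v.
Proof. by rewrite -[v]spi_repr -!spiZ scalerA. Qed.

Let sscale1 : left_id 1 sscale.
Proof. by move=> v; rewrite -[v]spi_repr -spiZ scale1r. Qed.

Let sscaleDr : right_distributive sscale +%R.
Proof.
move=> a u v; rewrite -[u]spi_repr -[v]spi_repr.
by rewrite -spiD -!spiZ -spiD scalerDr.
Qed.

Let sscaleDl v : {morph sscale^~ v : a b / a + b}.
Proof. by move=> a b; rewrite -[v]spi_repr -!spiZ -spiD scalerDl. Qed.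

HB.instance Definition _ :=
  GRing.Zmodule_isLmodule.Build R squot sscaleA sscale1 sscaleDr sscaleDl.

Definition snorm (x : squot) : R := p (repr x).

Lemma snorm_spi x : snorm (spi x) = p x.
Proof.
rewrite /snorm; have /eqP/spi_eqP e := spi_repr (spi x).
apply/eqP; rewrite eq_le; apply/andP; split.
  by rewrite -{1}[repr _](subrK x) (le_trans (seminormD _ _))// e add0r.
rewrite -{1}[x](subrK (repr (spi x))) (le_trans (seminormD _ _))//.
by rewrite -opprB seminormN e add0r.
Qed.

Let snormD x y : snorm (x + y) <= snorm x + snorm y.
Proof.
by rewrite -[x]spi_repr -[y]spi_repr -spiD !snorm_spi seminormD.
Qed.

Let snormZ a x : snorm (a *: x) = `|a| * snorm x.
Proof. by rewrite -[x]spi_repr -[a *: _]spiZ !snorm_spi seminormZ. Qed.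

Let spi0 : spi 0 = 0.
Proof. by apply: (addrI (spi 0)); rewrite -spiD !addr0. Qed.

Let snorm_eq0 x : snorm x = 0 -> x = 0.
Proof.
rewrite -[x]spi_repr snorm_spi => x0; apply/eqP.
rewrite -spi0.
by apply/spi_eqP; rewrite subr0.
Qed.

HB.instance Definition _ :=
  @Lmodule_isNormed.Build R squot snorm snormD snormZ snorm_eq0.

Definition sdot (x y : squot) : R := q (repr x) (repr y).

Let dot_null x y z : p (x - y) = 0 -> q x z = q y z.
Proof.
move=> /eqP; rewrite sqrtr_eq0 => xy0.
have /eqP qxy0 : q (x - y) (x - y) == 0 by rewrite eq_le xy0 dot_ge0.
have := dot_CauchySchwarz (x - y) z; rewrite qxy0 mul0r => qz.
have /eqP : q (x - y) z ^+ 2 == 0 by rewrite eq_le qz sqr_ge0.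
by move/eqP; rewrite sqrf_eq0 dotAl -scaleN1r dotZl mulN1r subr_eq0 => /eqP.
Qed.

Lemma sdot_spi x y : sdot (spi x) (spi y) = q x y.
Proof.
have e z : p (repr (spi z) - z) = 0 by apply/spi_eqP; rewrite spi_repr.
by rewrite /sdot (dot_null _ (e x)) dotC (dot_null _ (e y)) dotC.
Qed.

Lemma sdotC x y : sdot x y = sdot y x.
Proof. exact: dotC. Qed.

Lemma sdotDl a x y z : sdot (a *: x + y) z = a * sdot x z + sdot y z.
Proof.
rewrite -[x]spi_repr -[y]spi_repr -[z]spi_repr.
by rewrite -[a *: _]spiZ -spiD !sdot_spi dotDl.
Qed.

Lemma sdot0l y : sdot 0 y = 0.
Proof. by rewrite -spi0 -[y]spi_repr sdot_spi dot0l. Qed.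

Lemma sdot_ge0 x : 0 <= sdot x x.
Proof. exact: dot_ge0. Qed.

Lemma squot_normE x : `|x| = Num.sqrt (sdot x x).
Proof. by []. Qed.

End semidot_quotient.

(* The sigma-algebra generated by the coordinates; it is the Borel one. *)
Definition measure_rV_display : measure_display -> measure_display.
Proof. exact. Qed.

Section measurable_rV.
Context (R : realType) (n : nat).

Let coors : 'I_n -> 'rV[R]_n -> R := fun i x => x 0 i.

Let rV_set0 : g_sigma_preimage coors set0.
Proof. exact: sigma_algebra0. Qed.

Let rV_setC A : g_sigma_preimage coors A -> g_sigma_preimage coors (~` A).
Proof. exact: sigma_algebraC. Qed.

Let rV_bigcup (F : _^nat) : (forall i, g_sigma_preimage coors (F i)) ->
  g_sigma_preimage coors (\bigcup_i (F i)).
Proof. exact: sigma_algebra_bigcup. Qed.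

HB.instance Definition _ :=
  @isMeasurable.Build (measure_rV_display default_measure_display)
  'rV[R]_n (g_sigma_preimage coors) rV_set0 rV_setC rV_bigcup.

Lemma measurable_coord i : measurable_fun setT (fun x : 'rV[R]_n => x 0 i).
Proof.
move=> _ Y mY; rewrite setTI; apply: sub_sigma_algebra => /=.
rewrite -bigcup_seq/=; exists i => /=; first by rewrite mem_index_enum.
by exists Y => //; rewrite setTI.
Qed.

Lemma measurable_fun_rV d (T : measurableType d) (f : T -> 'rV[R]_n) :
  (forall i, measurable_fun setT (fun x => f x 0 i)) -> measurable_fun setT f.
Proof.
move=> mf.
have : g_sigma_preimage (fun i => coors i \o f) `<=` measurable.
  apply: smallest_sub; first exact: sigma_algebra_measurable.
  rewrite -bigcup_seq/=; apply: bigcup_sub => i _ A [B mB <-].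
  exact: (mf i).
rewrite g_sigma_preimage_comp => prefS _ A mA.
by apply: prefS; exists A.
Qed.

Definition box (M : R) := [set x : 'rV[R]_n | forall i, `|x 0 i| <= M].

Lemma measurable_box M : measurable (box M).
Proof.
rewrite (_ : box M = \bigcap_(i in [set: 'I_n])
    ((fun x : 'rV[R]_n => x 0 i) @^-1` `[- M, M])).
  apply: fin_bigcap_measurable => // i _.
  by rewrite -[X in measurable X]setTI; exact: measurable_coord.
apply/seteqP; split => x /= h i.
  by move=> _; rewrite /= in_itv/= -ler_norml; exact: h.
by have := h i I; rewrite /= in_itv/= -ler_norml.
Qed.

Let qbox (p : 'rV[rat]_n * rat) : set 'rV[R]_n :=
  \bigcap_(i in [set: 'I_n]) ((fun x : 'rV[R]_n => x 0 i) @^-1`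
    `]ratr (p.1 0 i) - ratr p.2, ratr (p.1 0 i) + ratr p.2[).

Lemma open_measurable_rV (A : set 'rV[R]_n) : open A -> measurable A.
Proof.
move=> oA.
have -> : A = \bigcup_p (if `[< qbox p `<=` A >] then qbox p else set0).
  apply/seteqP; split => [x Ax|x [p _]]; last first.
    by case: asboolP => // pA; exact: pA.
  have /nbhs_ballP[e /= e0 xeA] : nbhs x A by exact: open_nbhs_nbhs.
  have e20 : 0 < e / 2 by rewrite divr_gt0.
  have [r] := rat_in_itvoo e20.
  rewrite in_itv/= => /andP[r0 re].
  have cE i : {c | `|x 0 i - ratr c| < ratr r}.
    apply: cid.
    have [|c] := @rat_in_itvoo R (x 0 i - ratr r) (x 0 i + ratr r).
      by rewrite ltrBlDr -addrA ltrDl addr_gt0.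
    rewrite in_itv/= => /andP[c1 c2]; exists c.
    by rewrite distrC ltr_distl c1 c2.
  exists (\row_i projT1 (cE i), r) => //; case: asboolP => [_ i _|[]] /=.
    by rewrite in_itv/= mxE -ltr_distl; exact: projT2 (cE i).
  move=> y yc; apply: xeA; split=> // j i; rewrite (ord1 j) /ball/=.
  have := yc i I; rewrite /= in_itv/= mxE -ltr_distl.
  have := projT2 (cE i); move: re.
  rewrite !ltr_norml => re /andP[h1 h2] /andP[h3 h4].
  apply/andP; split; lra.
apply: countable_bigcupT_measurable => [|p]; first exact: countableP.
case: ifPn => // _; apply: fin_bigcap_measurable => // i _.
by rewrite -[X in measurable X]setTI; exact: measurable_coord.
Qed.

End measurable_rV.

Section lebesgue_measure_rV.
Context (R : realType).

(* (x_1, ..., x_n), t |-> (t, x_1, ..., x_n) *)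
Definition rV_cons n (p : 'rV[R]_n * measurableTypeR R) : 'rV[R]_n.+1 :=
  \row_i if unlift ord0 i is Some j then p.1 0 j else p.2.

Lemma rV_cons0 n (p : 'rV[R]_n * measurableTypeR R) : rV_cons p 0 ord0 = p.2.
Proof. by rewrite mxE unlift_none. Qed.

Lemma rV_consS n (p : 'rV[R]_n * measurableTypeR R) i : rV_cons p 0 (lift ord0 i) = p.1 0 i.
Proof. by rewrite mxE liftK. Qed.

Lemma measurable_rV_cons n : measurable_fun setT (@rV_cons n).
Proof.
apply: measurable_fun_rV => i; case: (unliftP ord0 i) => [j|] ->; last first.
  by under eq_fun do rewrite rV_cons0; exact: measurable_snd.
under eq_fun do rewrite rV_consS.
exact: (measurableT_comp (@measurable_coord R n j)).
Qed.

(* n-fold product of the Lebesgue measure on R *)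
Fixpoint lebesgue_rV n : {measure set 'rV[R]_n -> \bar R} :=
  match n with
  | 0 => \d_(0 : 'rV[R]_0)
  | m.+1 => measure_function_pushforward__canonical__measure_function_Measure
     (lebesgue_rV m \x lebesgue_measure)%E (@measurable_rV_cons m)
  end.

Lemma lebesgue_rVS n : lebesgue_rV n.+1 =
  pushforward (lebesgue_rV n \x lebesgue_measure)%E (@rV_cons n)
    :> (set 'rV[R]_n.+1 -> \bar R).
Proof. by []. Qed.

Lemma lebesgue_rV_box n M : (lebesgue_rV n (box M) < +oo)%E.
Proof.
elim: n => [|n ih]; first by rewrite /= /dirac indicE ltry.
rewrite lebesgue_rVS /pushforward.
have -> : @rV_cons n @^-1` box M = box M `*` `[- M, M].
  apply/seteqP; split => [p /= pM|p /= [pM1 pM2] i].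
    split => [i|]; first by rewrite -rV_consS; exact: pM.
    by rewrite in_itv/= -ler_norml -rV_cons0; exact: pM.
  case: (unliftP ord0 i) => [j|] ->; first by rewrite rV_consS.
  by rewrite rV_cons0; move: pM2; rewrite in_itv/= -ler_norml.
rewrite product_measure1E//; last exact: measurable_box.
rewrite lte_mul_pinfty// ?measure_ge0//.
  by rewrite ge0_fin_numE.
rewrite [X in (X < _)%E](_ : _ = lebesgue_measure (`[- M, M] : set R))//.
by rewrite lebesgue_measure_itv/=; case: ifP => // _; rewrite ltry.
Qed.

End lebesgue_measure_rV.

Section test_functions.
Context (R : realType) (d : nat).
Implicit Types (phi : 'rV[R]_d -> R) (Omega : set 'rV[R]_d).

Definition partial (i : 'I_d) phi : 'rV[R]_d -> R :=
  fun x => 'D_(delta_mx 0 i) phi x.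

Definition iter_partial (s : seq 'I_d) phi := foldr partial phi s.

Definition smooth phi := forall s,
  continuous (iter_partial s phi) /\
  forall i x, derivable (iter_partial s phi) x (delta_mx 0 i).

Definition test_function Omega phi := smooth phi /\
  exists K, [/\ compact K, K `<=` Omega & forall x, ~ K x -> phi x = 0].

Lemma partialP i a phi psi : smooth phi -> smooth psi ->
  partial i (a \*: phi \+ psi) = a \*: partial i phi \+ partial i psi.
Proof.
move=> /(_ [::]) [_ dphi] /(_ [::]) [_ dpsi]; apply/funext => x.
rewrite /partial deriveD//; last exact: derivableZ.
by rewrite deriveZ.
Qed.

Lemma smooth_partial i phi : smooth phi -> smooth (partial i phi).
Proof. by move=> sphi s; have := sphi (rcons s i); rewrite /iter_partial foldr_rcons. Qed.

Lemma smoothP a phi psi : smooth phi -> smooth psi ->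
  smooth (a \*: phi \+ psi).
Proof.
move=> sphi spsi s.
have -> : iter_partial s (a \*: phi \+ psi) =
    a \*: iter_partial s phi \+ iter_partial s psi.
  elim/last_ind: s phi psi sphi spsi => // s i ih phi psi sphi spsi.
  rewrite /iter_partial !foldr_rcons partialP//.
  by apply: ih; exact: smooth_partial.
have [cphi dphi] := sphi s; have [cpsi dpsi] := spsi s.
split => [x|i x]; last by apply: derivableD => //; exact: derivableZ.
by apply: continuousD; [apply: continuousZr; exact: cphi|exact: cpsi].
Qed.

Lemma test_functionP Omega a phi psi :
  test_function Omega phi -> test_function Omega psi ->
  test_function Omega (a \*: phi \+ psi).
Proof.
move=> [sphi [K [cK KO K0]]] [spsi [L [cL LO L0]]]; split; first exact: smoothP.
exists (K `|` L); split; first exact: compactU.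
  by move=> x [/KO|/LO].
move=> x /not_orP[Kx Lx]; rewrite /= K0// L0// addr0.
exact: mulr0.
Qed.

Lemma test_function0 Omega : test_function Omega (cst 0).
Proof.
split; last by exists set0; split => //; exact: compact0.
have p0 i : partial i (cst 0) = cst 0.
  by apply/funext => x; rewrite /partial derive_cst.
move=> s; have -> : iter_partial s (cst 0) = cst 0.
  by elim: s => //= i s ->.
by split => [x|i x]; [exact: cst_continuous|exact: derivable_cst].
Qed.

Lemma test_function_partial Omega i phi :
  test_function Omega phi -> test_function Omega (partial i phi).
Proof.
move=> [sphi [K [cK KO K0]]]; split; first exact: smooth_partial.
exists K; split => // x Kx.
have cl : closed K by apply: compact_closed => //; exact: norm_hausdorff.
suff h : \near x, phi x = cst 0 x by rewrite /partial (near_eq_derive _ h) derive_cst.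
have : nbhs x (~` K) by apply: open_nbhs_nbhs; split => //; exact: closed_openC.
by apply: filterS => y Ky; rewrite K0.
Qed.

Lemma continuous_measurable_fun_rV phi : continuous phi ->
  measurable_fun setT phi.
Proof.
move=> cphi; apply: (measurability _ (RGenOpens.measurableE R)).
move=> _ [_ [a [b ->] <-]]; rewrite setTI; apply: open_measurable_rV.
by apply: open_comp => [x _|]; [exact: cphi|exact: interval_open].
Qed.

Lemma test_function_box Omega phi : test_function Omega phi ->
  exists M, 0 <= M /\ forall x, `|phi x| <= M * \1_(box M) x.
Proof.
move=> [sphi [K [cK KO K0]]]; have [cphi _] := sphi [::].
have [M1 [_ M1P]] := compact_bounded cK.
have [M2 [_ M2P]] : bounded_set (phi @` K).
  apply: compact_bounded; apply: continuous_compact => //.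
  by apply: continuous_subspaceT => x; exact: cphi.
pose M := Num.max 0 (Num.max (M1 + 1) (M2 + 1)).
have M0 : 0 <= M by rewrite le_max lexx.
have MM1 : M1 < M by rewrite !lt_max ltrDl ltr01 orbT.
have MM2 : M2 < M by rewrite !lt_max ltrDl ltr01 !orbT.
exists M; split => // x; have [Kx|Kx] := pselect (K x); last first.
  by rewrite K0// normr0 mulr_ge0// indicE.
rewrite indicE mem_set ?mulr1; first by apply: (M2P M) => //; exists x.
move=> i; apply: le_trans (M1P M MM1 x Kx).
rewrite [leRHS]mx_normrE; exact: (le_bigmax _ (fun ij => `|x ij.1 ij.2|) (0, i)).
Qed.

End test_functions.

Section L2.
Context (R : realType) (d : nat) (Omega : set 'rV[R]_d) (oOmega : open Omega).

(* Lebesgue measure on Omega, seen as a measure on R^d *)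
Definition leb : {measure set 'rV[R]_d -> \bar R} :=
  mrestr (lebesgue_rV R d) (open_measurable_rV oOmega).

Definition preL2 := LfunType leb (lee1n 2).
HB.instance Definition _ := GRing.Lmodule.on preL2.

Lemma preL2_integrable (f g : preL2) : leb.-integrable setT (EFin \o (f \* g)).
Proof.
by apply/Lfun1_integrable/Lfun2_mul_Lfun1; exact: LfunP.
Qed.

Definition preL2_dot (f g : preL2) : R := \int[leb]_x (f x * g x).

Let preL2_dotC f g : preL2_dot f g = preL2_dot g f.
Proof. by apply: eq_Rintegral => x _; rewrite mulrC. Qed.

Let preL2_dotDl a f g h :
  preL2_dot (a *: f + g) h = a * preL2_dot f h + preL2_dot g h.
Proof.
have ifh := preL2_integrable f h; have igh := preL2_integrable g h.
rewrite -RintegralZl// -RintegralD//.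
  by apply: eq_Rintegral => x _; rewrite /= mulrDl -mulrA.
have := preL2_integrable (a *: f) h; apply: eq_integrable => // x _ /=.
by rewrite -mulrA.
Qed.

Let preL2_dot_ge0 f : 0 <= preL2_dot f f.
Proof. by apply: Rintegral_ge0 => x _; rewrite -expr2 sqr_ge0. Qed.

Definition L2_semidot : semidot preL2 :=
  Semidot preL2_dotC preL2_dotDl preL2_dot_ge0.

Definition L2 := squot L2_semidot.
HB.instance Definition _ := NormedModule.on L2.

Definition L2_fun (u : L2) : 'rV[R]_d -> R := (repr u : preL2).

Definition L2_dot (u v : L2) : R := sdot u v.

End L2.
Coercion L2_fun : L2 >-> Funclass.

Section H01.
Context (R : realType) (d : nat) (Omega : set 'rV[R]_d) (oOmega : open Omega).
Local Notation mu := (leb oOmega).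
Local Notation L2 := (L2 oOmega).
Local Notation test_function := (test_function Omega).
Implicit Types (u v g : L2) (phi : 'rV[R]_d -> R).

Let L2_ae0 (f : preL2 oOmega) : seminorm (L2_semidot oOmega) f = 0 ->
  {ae mu, forall x, f x = 0}.
Proof.
move=> /eqP; rewrite sqrtr_eq0 => ff0.
have /eqP ff : L2_semidot oOmega f f == 0 by rewrite eq_le ff0 dot_ge0.
have iff := preL2_integrable f f.
have [mff _] := integrableP _ _ _ iff.
have [+ _] := @ae_eq_integral_abs _ _ _ mu _ measurableT _ mff.
have -> : (\int[mu]_x `|(f x * f x)%R%:E| = 0)%E.
  transitivity (\int[mu]_x (f x * f x)%R%:E)%E.
    by apply: eq_integral => x _; rewrite /= ger0_norm// -expr2 sqr_ge0.
  rewrite -[LHS]fineK; first by congr EFin; exact: ff.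
  exact: (integrable_fin_num _ iff).
move=> /(_ erefl); apply: filterS => x /(_ I)/= [] /eqP.
by rewrite mulf_eq0 orbb => /eqP.
Qed.

Lemma L2_spi (f : preL2 oOmega) :
  {ae mu, forall x, (spi _ f : L2) x = f x}.
Proof.
have : seminorm (L2_semidot oOmega) (repr (spi (L2_semidot oOmega) f) - f) = 0.
  by apply/spi_eqP; rewrite spi_repr.
by move=> /L2_ae0; apply: filterS => x /= /eqP; rewrite subr_eq0 => /eqP.
Qed.

Lemma L2_funD a u v : {ae mu, forall x, (a *: u + v : L2) x = a * u x + v x}.
Proof.
have -> : a *: u + v = spi _ (a *: (repr u : preL2 oOmega) + repr v).
  by rewrite spiD -[v in LHS]spi_repr.
exact: L2_spi.
Qed.

Let L2_fun0 : {ae mu, forall x, (0 : L2) x = 0}.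
Proof.
have := L2_funD (-1) 0 0; rewrite scaler0 addr0.
by apply: filterS => x ->; rewrite mulN1r addNr.
Qed.

Lemma test_function_Lfun phi : test_function phi -> phi \in Lfun mu 2%:E.
Proof.
move=> tphi; have [M [M0 phiM]] := test_function_box tphi.
have mphi : measurable_fun setT phi.
  by apply: continuous_measurable_fun_rV; exact: (tphi.1 [::]).1.
apply/andP; split; rewrite inE//=.
rewrite /finite_norm unlock /Lnorm poweR_lty//.
rewrite (eq_integral (fun x => (phi x ^+ 2)%:E)); last first.
  by move=> x _; rewrite -[`|_|%E]/(`|phi x|%:E)%E poweR_EFin powR_mulrn// real_normK// num_real.
apply: (@le_lt_trans _ _ (\int[mu]_x (M ^+ 2 * \1_(box M) x)%:E)%E).
  apply: ge0_le_integral => //.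
  - by move=> x _; rewrite lee_fin sqr_ge0.
  - by apply/measurable_EFinP; exact: measurable_funX.
  - apply/measurable_EFinP; apply: measurable_funM => //.
    by apply: measurable_indic; exact: measurable_box.
  - move=> x _; rewrite lee_fin -[phi x ^+ 2]real_normK ?num_real//.
    rewrite (le_trans (lerXn2r _ _ _ (phiM x)))//= ?nnegrE ?mulr_ge0//.
    rewrite exprMn ler_wpM2l ?sqr_ge0// indicE.
    by case: (_ \in _); rewrite ?expr1n ?expr0n.
under eq_integral do rewrite EFinM.
rewrite ge0_integralZl//.
- rewrite integral_indic//; last exact: measurable_box.
  rewrite setIT lte_mul_pinfty// ?lee_fin ?sqr_ge0//.
  apply: le_lt_trans (lebesgue_rV_box d M); apply: le_measure; rewrite ?inE//.
  + by apply: measurableI; [exact: measurable_box|exact: open_measurable_rV].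
  + exact: measurable_box.
- by apply/measurable_EFinP; apply: measurable_indic; exact: measurable_box.
- by rewrite lee_fin sqr_ge0.
Qed.

Definition preL2_test phi (tphi : test_function phi) : preL2 oOmega :=
  Lfun_Sub (lee1n 2) (test_function_Lfun tphi).

Let int_test u phi (tphi : test_function phi) :
  \int[mu]_x (u x * phi x) = sdot u (spi _ (preL2_test tphi)).
Proof. by rewrite -[u in RHS]spi_repr sdot_spi. Qed.

Definition weak_partial i v g := forall phi, test_function phi ->
  \int[mu]_x (v x * partial i phi x) = - \int[mu]_x (g x * phi x).

Definition preH1 := (L2 * {ffun 'I_d -> L2})%type.
HB.instance Definition _ := GRing.Lmodule.on preH1.

Let preH1E a (w z : preH1) i : (a *: w + z).2 i = a *: w.2 i + z.2 i.
Proof. by rewrite !ffunE. Qed.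

(* w.2 is the weak gradient of w.1, so that w.1 ranges over H^1(Omega) *)
Definition H1 (w : preH1) := forall i, weak_partial i w.1 (w.2 i).

Definition is_test (w : preH1) := exists2 phi, test_function phi &
  {ae mu, forall x, (w.1 : L2) x = phi x} /\
  forall i, {ae mu, forall x, (w.2 i : L2) x = partial i phi x}.

(* The closure in H^1(Omega) of C_c^oo(Omega), embedded by is_test: the norm of
   H^1(Omega) is equivalent to the maximum of the L^2 norms of the components. *)
Definition in_H01 : {pred preH1} := mem [set w | H1 w /\
  forall e, 0 < e -> exists2 w', is_test w' &
    `|w.1 - w'.1| < e /\ forall i, `|w.2 i - w'.2 i| < e].

Lemma in_H01_submod_closed : submod_closed in_H01.
Proof.
split.
  rewrite inE; split.
    move=> i phi tphi; have tp := test_function_partial i tphi.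
    rewrite /= ffunE (int_test 0 tp) (int_test 0 tphi).
    by rewrite !sdot0l oppr0.
  move=> e e0; exists 0; last by split => [|i]; rewrite subrr normr0.
  exists (cst 0); first exact: test_function0.
  have c0 i : partial i (cst 0 : 'rV[R]_d -> R) = cst 0.
    by apply/funext => x; rewrite /partial derive_cst.
  split => [|i]; first exact: L2_fun0.
  by rewrite c0 /= ffunE; exact: L2_fun0.
move=> a w z; rewrite !inE => -[w1 w2] [z1 z2]; split.
  move=> i phi tphi; have tp := test_function_partial i tphi.
  have := w1 i _ tphi; have := z1 i _ tphi.
  rewrite !(int_test _ tp) !(int_test _ tphi) => ez ew.
  have -> : (a *: w + z).1 = a *: w.1 + z.1 by [].
  rewrite preH1E !sdotDl ez ew.
  by rewrite opprD mulrN.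
move=> e e0; have a1 : 0 < `|a| + 1 by rewrite ltr_wpDl.
have [w' [phi tphi [wphi wphi']] [dw dw']] := w2 _ (divr_gt0 e0 a1).
have [z' [psi tpsi [zpsi zpsi']] [dz dz']] := z2 _ (divr_gt0 e0 a1).
have lem (x y x' y' : L2) : `|x - x'| < e / (`|a| + 1) ->
    `|y - y'| < e / (`|a| + 1) -> `|(a *: x + y) - (a *: x' + y')| < e.
  move=> hx hy; rewrite opprD addrACA -scalerBr.
  rewrite (le_lt_trans (ler_normD _ _))// normrZ.
  have -> : e = `|a| * (e / (`|a| + 1)) + e / (`|a| + 1).
    by field; rewrite gt_eqF.
  by rewrite ler_ltD// ler_wpM2l// ltW.
exists (a *: w' + z'); last first.
  by split => [|i]; [exact: lem|rewrite !preH1E; exact: lem].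
exists (a \*: phi \+ psi); first exact: test_functionP.
split => [|i].
  move: wphi zpsi (L2_funD a w'.1 z'.1).
  by apply: filterS3 => x /= h1 h2 ->; rewrite h1 h2.
rewrite partialP; [|exact: tphi.1|exact: tpsi.1].
move: (wphi' i) (zpsi' i) (L2_funD a (w'.2 i) (z'.2 i)).
by rewrite preH1E; apply: filterS3 => x /= h1 h2 ->; rewrite h1 h2.
Qed.

HB.instance Definition _ :=
  GRing.isSubmodClosed.Build R preH1 in_H01 in_H01_submod_closed.

Record preH01 := PreH01 { preH01_val :> preH1; _ : preH01_val \in in_H01 }.
HB.instance Definition _ := [isSub for preH01_val].
HB.instance Definition _ := [Choice of preH01 by <:].
HB.instance Definition _ := [SubChoice_isSubLmodule of preH01 by <:].

Definition grad_dot (v w : preH01) : R :=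
  \sum_(i < d) L2_dot ((val v).2 i) ((val w).2 i).

Let grad_dotC (v w : preH01) : grad_dot v w = grad_dot w v.
Proof. by apply: eq_bigr => i _; exact: sdotC. Qed.

Let grad_dotDl a (v w z : preH01) :
  grad_dot (a *: v + w) z = a * grad_dot v z + grad_dot w z.
Proof.
rewrite /grad_dot mulr_sumr -big_split/=; apply: eq_bigr => i _.
by rewrite /= preH1E; exact: sdotDl.
Qed.

Let grad_dot_ge0 (v : preH01) : 0 <= grad_dot v v.
Proof. by apply: sumr_ge0 => i _; exact: sdot_ge0. Qed.

Definition H01_semidot : semidot preH01 :=
  Semidot grad_dotC grad_dotDl grad_dot_ge0.

(* The norm of H01 is the L^2 norm of the gradient. For bounded Omega (and
   d > 0) it is definite on preH01 by Poincare's inequality, so that the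
   quotient identifies nothing and H01_L2 does not depend on repr. *)
Definition H01 := squot H01_semidot.
HB.instance Definition _ := NormedModule.on H01.

Definition H01_L2 (v : H01) : L2 := (val (repr v)).1.

Definition H01_dot (v w : H01) : R := sdot v w.

End H01.
Coercion H01_L2 : H01 >-> L2.


Section control_problem.
Context (R : realType) (d : nat) (Omega : set 'rV[R]_d) (oOmega : open Omega).
Variable alpha : R.
Local Notation mu := (leb oOmega).
Local Notation L2 := (L2 oOmega).
Local Notation H01 := (H01 oOmega).
Implicit Types (u : L2) (y v z : H01).

(* - Delta y + sgn(y) |y|^alpha = u in Omega, y = 0 on the boundary, in the
   weak sense; u acts on H01 through L2 = L2^* c H^{-1} *)
Definition weak_solution u y := forall v,
  H01_dot y v + \int[mu]_x (Num.sg (y x) * `|y x| `^ alpha * v x) = L2_dot u v.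

Definition Vspace y : set H01 := [set v |
  (\int[mu]_(x in [set x | y x != 0%R])
     (v x ^+ 2 / `|y x| `^ (1 - alpha))%:E < +oo)%E /\
  {ae mu, forall x, y x = 0 -> v x = 0}].

Definition lin_form y v z : R :=
  H01_dot v z +
  alpha * \int[mu]_(x in [set x | y x != 0]) (v x * z x / `|y x| `^ (1 - alpha)).

(* the Riesz representative of f under L2 = L2^* *)
Definition L2_riesz (f : L2 -> R) : L2 :=
  get [set g | forall h, f h = L2_dot g h].

End control_problem.

(* Main.v *)
Require Import Defs.
From mathcomp Require Import all_boot all_order all_algebra.
From mathcomp Require Import all_classical all_reals all_analysis.
From mathcomp Require Import measurable_realfun ring lra.

(* Write g(s) = sgn(s)|s|^alpha, y = S(ubar) and, for t_n decreasing fast to 0,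
   delta_n = (S(ubar + t_n h) - y) / t_n, which tends to delta = S'(ubar) h in H^1_0 and a.e.
   Testing the difference of the state equations with delta_n, monotonicity of g and
   Fatou's lemma give delta = 0 a.e. on {y = 0}. With D_n = (g(y_n) - g(y)) / t_n and
   w = |y|^(alpha-1), the chord bound |g(b) - g(a)| <= 2 |a|^(alpha-1) |b - a| makes
   1_{y <> 0} D_n delta_n - 2 D_n z + 2 w z^2 nonnegative for every z in V_y, while its
   integral is at most a quantity with an explicit limit by the state equations. Fatou's
   lemma then gives delta in V_y and L(delta) - 2 L(z) <= 0 for all z in V_y, where
   L(z) = (delta, z) + alpha \int w delta z - (h, z) is linear, so that L = 0: this is the
   linearized equation for delta.
   Minimizing sequences converge in V_y, so the adjoint equation is solvable by Riesz
   representation, and symmetry of the form yields <d_y J, S'(ubar) h> = (pbar, h), which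
   turns Bouligand stationarity into the last line of the KKT system and back. *)

Set Implicit Arguments.
Unset Strict Implicit.
Unset Printing Implicit Defensive.
Import Order.TTheory GRing.Theory Num.Theory.
Import numFieldNormedType.Exports.
Local Open Scope classical_set_scope.
Local Open Scope ring_scope.

(** * The nonlinearity *)

Section signed_power.
Context (R : realType) (alpha : R).
Hypotheses (alpha_gt0 : 0 < alpha) (alpha_lt1 : alpha < 1).
Implicit Types a b d s t : R.

Definition spow s : R := Num.sg s * `|s| `^ alpha.

(* At a = 0 this is 0^-1 = 0: integrals over {y <> 0} weighted by |y|^(alpha-1) are
   therefore integrals over the whole space. *)
Definition weight a : R := (`|a| `^ (1 - alpha))^-1.

Let alpha_neq0 : alpha != 0. Proof. by rewrite gt_eqF. Qed.
Let beta_gt0 : 0 < 1 - alpha. Proof. by rewrite subr_gt0. Qed.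

Lemma weight_ge0 a : 0 <= weight a.
Proof. by rewrite invr_ge0 powR_ge0. Qed.

Lemma weight0 : weight 0 = 0.
Proof. by rewrite /weight normr0 powR0 ?invr0// gt_eqF. Qed.

Lemma spow0 : spow 0 = 0.
Proof. by rewrite /spow sgr0 mul0r. Qed.

Lemma spowN s : spow (- s) = - spow s.
Proof. by rewrite /spow sgrN normrN mulNr. Qed.

Lemma spow_ge0 s : 0 <= s -> spow s = s `^ alpha.
Proof.
rewrite le_eqVlt => /predU1P[<-|s0]; first by rewrite spow0 powR0.
by rewrite /spow gtr0_sg// mul1r gtr0_norm.
Qed.

Lemma spow_mul s : spow s * s = `|s| `^ alpha * `|s|.
Proof. by rewrite /spow mulrAC -normrEsg mulrC. Qed.

Lemma spow_scale t s : 0 < t -> spow (t * s) = t `^ alpha * spow s.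
Proof.
by move=> t0; rewrite /spow sgrM gtr0_sg// mul1r normrM gtr0_norm// powRM ?(ltW t0)// mulrCA.
Qed.

(** Linear growth makes [spow (y x) * v x] integrable over a bounded domain. For |s| <= 1 the power
    is at most 1, and for |s| > 1 it is at most |s| since alpha < 1. *)
Lemma norm_spow_le s : `|spow s| <= 1 + `|s|.
Proof.
rewrite /spow normrM (ger0_norm (powR_ge0 _ _)).
apply: (@le_trans _ _ (`|s| `^ alpha)).
  rewrite ler_piMl ?powR_ge0//; have [->|s0] := eqVneq s 0; first by rewrite sgr0 normr0.
  by rewrite normr_sg s0.
have [s1|s1] := leP `|s| 1.
  have := ge0_ler_powR (ltW alpha_gt0) _ _ s1; rewrite !nnegrE powR1 => h.
  by rewrite (le_trans (h _ _))// lerDl.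
by rewrite (le_trans (ler_powR (ltW s1) (ltW alpha_lt1)))// powRr1// lerDr.
Qed.

Lemma ler_spow a b : a <= b -> spow a <= spow b.
Proof.
have pos u v : 0 <= u -> u <= v -> spow u <= spow v.
  move=> u0 uv; have v0 := le_trans u0 uv.
  by rewrite !spow_ge0//; apply: ge0_ler_powR => //; exact: ltW.
move=> ab; have [a0|a0] := leP 0 a; first exact: pos.
have [b0|b0] := leP 0 b.
  apply: (@le_trans _ _ 0); last by rewrite spow_ge0// powR_ge0.
  by rewrite -oppr_ge0 -spowN spow_ge0 ?powR_ge0// oppr_ge0 ltW.
by have := pos (- b) (- a); rewrite !spowN !lerN2 oppr_ge0; apply => //; exact: ltW.
Qed.

Lemma spow_monotone a b : 0 <= (spow b - spow a) * (b - a).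
Proof.
have [/[dup] ab /ler_spow gab|/ltW /[dup] ab /ler_spow gab] := leP a b.
  by rewrite mulr_ge0// subr_ge0.
by rewrite -mulrNN mulr_ge0// oppr_ge0 subr_le0.
Qed.

(** A weighted geometric mean of a and b lies between them. It appears when a chord of s^alpha
    through a is multiplied by a^(1-alpha). *)
Let geometric_mean a b : 0 < a -> 0 <= b ->
  (a <= b -> a <= b `^ alpha * a `^ (1 - alpha) <= b) /\
  (b <= a -> b <= b `^ alpha * a `^ (1 - alpha) <= a).
Proof.
move=> a0 b0; have split c : 0 <= c -> c `^ alpha * c `^ (1 - alpha) = c.
  move=> c0; have e : alpha + (1 - alpha) = 1 by ring.
  by rewrite -powRD e ?powRr1// oner_eq0.
have mono r u v : 0 <= r -> 0 <= u -> u <= v -> u `^ r <= v `^ r.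
  by move=> r0 u0 uv; apply: ge0_ler_powR; rewrite ?nnegrE// (le_trans u0).
have sa := split a (ltW a0); have sb := split b b0.
split=> ab; apply/andP; split.
- by rewrite -[leLHS]sa ler_wpM2r ?powR_ge0 ?mono ?(ltW alpha_gt0) ?(ltW a0).
- by rewrite -[leRHS]sb ler_wpM2l ?powR_ge0 ?mono ?(ltW beta_gt0) ?(ltW a0).
- by rewrite -[leLHS]sb ler_wpM2l ?powR_ge0 ?mono ?(ltW beta_gt0).
- by rewrite -[leRHS]sa ler_wpM2r ?powR_ge0 ?mono ?(ltW alpha_gt0).
Qed.

Let spow_lip_pos a b : 0 < a -> `|spow b - spow a| <= 2 * weight a * `|b - a|.
Proof.
move=> a0; rewrite /weight (gtr0_norm a0).
have aa : a `^ alpha * a `^ (1 - alpha) = a.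
  have [/(_ (lexx _)) + _] := geometric_mean a0 (ltW a0).
  by rewrite -eq_le => /eqP.
have p0 : 0 < a `^ (1 - alpha) by rewrite powR_gt0.
(* Multiplication by a^(1-alpha) turns g(a) into a and, for b >= 0, g(b) into the geometric mean of
   a and b. *)
rewrite mulrAC ler_pdivlMr// -{1}(gtr0_norm p0) -normrM mulrBl.
rewrite (spow_ge0 (ltW a0)) aa.
have [b0|b0] := leP 0 b.
  have [h1 h2] := geometric_mean a0 b0; rewrite (spow_ge0 b0).
  have [ab|/ltW ab] := leP a b.
    by have /andP[] := h1 ab => u v; rewrite !ger0_norm; lra.
  by have /andP[] := h2 ab => u v; rewrite !ler0_norm; lra.
(* For b < 0 the left side is a plus the mean of a and -b, hence at most a + max(a, -b) <= 2 (a -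
   b); this case is the source of the factor 2. *)
have nb0 : 0 <= - b by rewrite oppr_ge0 ltW.
have [h1 h2] := geometric_mean a0 nb0.
rewrite -(opprK b) spowN (spow_ge0 nb0) mulNr -!opprD !normrN.
move: h1 h2 (powR_ge0 (- b) alpha).
set c := _ `^ alpha; move=> h1 h2 c0.
have cp : 0 <= c * a `^ (1 - alpha) by rewrite mulr_ge0 ?powR_ge0.
rewrite !ger0_norm; [|lra|lra].
by have [ab|/ltW ab] := leP a (- b); [have /andP[] := h1 ab|have /andP[] := h2 ab]; lra.
Qed.

(* Concavity of s |-> s^alpha bounds all chord slopes through (a, g(a)) by twice |a|^(alpha-1). *)
Lemma spow_lip a b : a != 0 -> `|spow b - spow a| <= 2 * weight a * `|b - a|.
Proof.
move=> a0; have [ap|an] := ltP 0 a; first exact: spow_lip_pos.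
have := @spow_lip_pos (- a) (- b).
rewrite oppr_gt0 !spowN -!opprD !normrN /weight normrN; apply.
by rewrite lt_neqAle a0.
Qed.

Lemma spow_mul_cvg (a_ : nat -> R) a : a_ @ \oo --> a ->
  spow (a_ n) * a_ n @[n --> \oo] --> spow a * a.
Proof.
move=> aa; have [a0|a0] := eqVneq a 0.
  rewrite a0 mulr0; rewrite a0 in aa; apply/norm_cvg0P.
  have c0 : (1 + `|a_ n|) * `|a_ n| @[n --> \oo] --> (0 : R).
    rewrite -(mulr0 (1 + `|0 : R|)) -[X in _ * X](@normr0 _ R).
    apply: cvgM; last exact: cvg_norm.
    by apply: cvgD; [exact: cvg_cst|exact: cvg_norm].
  apply: (squeeze_cvgr _ (cvg_cst (0 : R)) c0); apply: nearW => n.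
  by rewrite normr_ge0 normrM ler_wpM2r// norm_spow_le.
apply: cvgM => //; apply/cvgrPdistC_le => e e0.
have K0 : 0 < 2 * weight a + 1 by rewrite ltr_wpDl// mulr_ge0// weight_ge0.
have /cvgrPdistC_le/(_ (e / (2 * weight a + 1))) := aa; rewrite divr_gt0// => /(_ isT).
apply: filterS => n h; apply: (le_trans (spow_lip _ a0)).
apply: (@le_trans _ _ ((2 * weight a + 1) * `|a_ n - a|)).
  by rewrite ler_wpM2r// lerDl.
by rewrite -ler_pdivlMl// mulrC.
Qed.

Let is_derive_spow a : 0 < a -> is_derive a 1 spow (alpha * weight a).
Proof.
move=> a0; have -> : weight a = a `^ (alpha - 1).
  by rewrite /weight gtr0_norm// -powRN opprB.
have e : \forall x \near a, x `^ alpha = spow x.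
  near=> x; rewrite spow_ge0//; apply: ltW; near: x; exact: lt_nbhsr.
exact: near_eq_is_derive e (is_derive1_powR alpha a0).
Unshelve. all: by end_near. Qed.

Let spow_quotient_pos a (t_ d_ : nat -> R) d : 0 < a ->
  (forall n, t_ n != 0) -> t_ @ \oo --> (0 : R) -> d_ @ \oo --> d ->
  (spow (a + t_ n * d_ n) - spow a) / t_ n @[n --> \oo] --> alpha * weight a * d.
Proof.
move=> a0 t_neq0 t0 dd.
(* The difference quotient of g at a, continued by the derivative at h = 0, so that indices with t_n
   d_n = 0 are covered. Multiplying by d_n recovers the quotient by t_n. *)
pose phi h := if h == 0 then alpha * weight a else h^-1 * (spow (h + a) - spow a).
have phi0 : phi h @[h --> (0 : R)] --> phi 0.
  apply/continuous_withinNx; rewrite {2}/phi eqxx.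
  have [dg <-] := is_derive_spow a0.
  apply: cvg_trans (dg); apply: near_eq_cvg; near=> h.
  have h0 : h != 0 by near: h; exact: nbhs_dnbhs_neq.
  by rewrite /phi (negbTE h0)/= -[_%:A]/(h * 1) mulr1.
have s0 : t_ n * d_ n @[n --> \oo] --> (0 : R) by rewrite -(mul0r d); exact: cvgM.
have h : phi (t_ n * d_ n) * d_ n @[n --> \oo] --> phi 0 * d.
  by apply: cvgM => //; exact: continuous_cvg.
rewrite {2}/phi eqxx in h; apply: cvg_trans h; apply: near_eq_cvg; apply: nearW => n /=.
rewrite /phi; have tn := t_neq0 n; case: ifPn => [|s_neq0].
  by rewrite mulf_eq0 (negbTE tn)/= => /eqP ->; rewrite !mulr0 addr0 subrr mul0r.
have dn : d_ n != 0 by apply: contraNneq s_neq0 => ->; rewrite mulr0.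
by rewrite [_ + a]addrC; field; rewrite tn dn.
Unshelve. all: by end_near. Qed.

(** Identifies the pointwise limit of D_n on {y <> 0}, along directions that vary with n. Oddness of
    g reduces a < 0 to a > 0. *)
Lemma spow_quotient_cvg a (t_ d_ : nat -> R) d : a != 0 ->
  (forall n, t_ n != 0) -> t_ @ \oo --> (0 : R) -> d_ @ \oo --> d ->
  (spow (a + t_ n * d_ n) - spow a) / t_ n @[n --> \oo] --> alpha * weight a * d.
Proof.
move=> a0 t_neq0 t0 dd; have [an|ap|a00] := ltgtP a 0; last by rewrite a00 eqxx in a0.
  have an0 : 0 < - a by rewrite oppr_gt0.
  have h : - ((spow (- a + t_ n * - d_ n) - spow (- a)) / t_ n) @[n --> \oo] -->
      - (alpha * weight (- a) * - d).
    by apply: cvgN; apply: spow_quotient_pos => //; exact: cvgN.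
  rewrite /weight normrN mulrN opprK in h; apply: cvg_trans h.
  apply: near_eq_cvg; apply: nearW => n.
  by rewrite /= mulrN -opprD !spowN -opprD mulNr opprK.
exact: spow_quotient_pos.
Qed.

Lemma measurable_spow : measurable_fun setT spow.
Proof.
apply: nondecreasing_measurable => //.
by move=> x y; exact: ler_spow.
Qed.

Lemma measurable_weight : measurable_fun setT weight.
Proof.
have -> : weight = (@powR R ^~ (alpha - 1)) \o Num.norm.
  by apply/funext => a; rewrite /weight -powRN opprB.
by apply: measurableT_comp => //; exact: measurable_powR.
Qed.

End signed_power.

(** * Integration *)

Section ae_integration.
Context d (T : measurableType d) (R : realType) (mu : {measure set T -> \bar R}).
Implicit Types f g : T -> R.

Lemma measurable_of_integrable f :
  mu.-integrable setT (EFin \o f) -> measurable_fun setT f.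
Proof. by move=> /measurable_int/measurable_EFinP. Qed.

Lemma integrable_EFin_Rintegral f : mu.-integrable setT (EFin \o f) ->
  (\int[mu]_x (f x)%:E)%E = (\int[mu]_x f x)%:E.
Proof.
by move=> fi; rewrite /Rintegral fineK//; exact: integrable_fin_num.
Qed.

Lemma ae_eq_Rintegral f g : measurable_fun setT f -> measurable_fun setT g ->
  {ae mu, forall x, f x = g x} -> \int[mu]_x f x = \int[mu]_x g x.
Proof.
move=> mf mg fg; rewrite /Rintegral; congr fine.
apply: ae_eq_integral => //; [exact/measurable_EFinP|exact/measurable_EFinP|].
by apply: filterS fg => x /= -> _.
Qed.

Lemma ae_eq_integrable f g : measurable_fun setT f ->
  {ae mu, forall x, f x = g x} ->
  mu.-integrable setT (EFin \o g) -> mu.-integrable setT (EFin \o f).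
Proof.
move=> mf fg /integrableP[mg gi]; apply/integrableP; split; first exact/measurable_EFinP.
rewrite (@ae_eq_integral _ _ _ _ setT (fun x => `|(EFin \o g) x|)%E)//.
- by apply: measurableT_comp => //; exact/measurable_EFinP.
- exact: measurableT_comp.
- by apply: filterS fg => x /= -> _.
Qed.

Lemma integrable_le_abs f g : measurable_fun setT f ->
  (forall x, `|f x| <= g x) ->
  mu.-integrable setT (EFin \o g) -> mu.-integrable setT (EFin \o f).
Proof.
move=> mf fg; apply: le_integrable => //; first exact/measurable_EFinP.
by move=> x _ /=; rewrite lee_fin (le_trans (fg x))// ler_norm.
Qed.

Lemma integrable_EFinD f g : mu.-integrable setT (EFin \o f) ->
  mu.-integrable setT (EFin \o g) ->
  mu.-integrable setT (EFin \o (fun x => f x + g x)).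
Proof.
by move=> fi gi; rewrite (_ : _ \o _ = (EFin \o f) \+ (EFin \o g))//; exact: integrableD.
Qed.

Lemma integrable_EFinZ c f : mu.-integrable setT (EFin \o f) ->
  mu.-integrable setT (EFin \o (fun x => c * f x)).
Proof.
move=> fi; rewrite (_ : _ \o _ = (fun x => c%:E * (EFin \o f) x)%E)//.
exact: integrableZl.
Qed.

Lemma integrable_finite f : measurable_fun setT f -> (forall x, 0 <= f x) ->
  (\int[mu]_x (f x)%:E < +oo)%E -> mu.-integrable setT (EFin \o f).
Proof.
move=> mf f0 fi; apply/integrableP; split; first exact/measurable_EFinP.
rewrite (eq_integral (fun x => (f x)%:E))// => x _.
by rewrite /= ger0_norm.
Qed.

Lemma ae_Rintegral0 f : mu.-integrable setT (EFin \o f) -> (forall x, 0 <= f x) ->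
  \int[mu]_x f x = 0 -> {ae mu, forall x, f x = 0}.
Proof.
move=> fi f0 i0.
have [mf _] := integrableP _ _ _ fi.
have [+ _] := @ae_eq_integral_abs _ _ _ mu _ measurableT _ mf.
have -> : (\int[mu]_x `|(EFin \o f) x| = 0)%E.
  transitivity (\int[mu]_x (f x)%:E)%E.
    by apply: eq_integral => x _; rewrite /= ger0_norm.
  by rewrite integrable_EFin_Rintegral// i0.
by move=> /(_ erefl); apply: filterS => x /(_ I)/= [].
Qed.

(** Fatou's lemma is applied to |f_n|, which agrees with f_n almost everywhere. The convergent
    bounds c_n control the lower limit of the integrals and give integrability of the limit as
    well. *)
Lemma fatou_ae (f_ : nat -> T -> R) f (c_ : nat -> R) c :
  (forall n, mu.-integrable setT (EFin \o f_ n)) -> measurable_fun setT f ->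
  (forall n, {ae mu, forall x, 0 <= f_ n x}) ->
  {ae mu, forall x, f_ n x @[n --> \oo] --> f x} ->
  (forall n, \int[mu]_x f_ n x <= c_ n) -> c_ @ \oo --> c ->
  mu.-integrable setT (EFin \o f) /\ \int[mu]_x f x <= c.
Proof.
move=> fi mf f0 ff fc cc.
have mf_ n : measurable_fun setT (f_ n) by exact: measurable_of_integrable.
have ae0 : {ae mu, forall x, forall n, 0 <= f_ n x} by exact/ae_foralln.
have fge0 : {ae mu, forall x, `|f x| = f x}.
  apply: filterS2 ae0 ff => x fx0 fx; rewrite ger0_norm//.
  by rewrite -(cvg_lim _ fx)//; apply: limr_ge; [apply/cvg_ex; exists (f x)|exact: nearW].
have mabs n : measurable_fun setT (fun x => `|f_ n x|%:E).
  by apply/measurable_EFinP; exact: measurableT_comp.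
have mabsf : measurable_fun setT (fun x => `|f x|).
  exact: measurableT_comp.
have fat : (\int[mu]_x `|f x|%:E <= c%:E)%E.
  have h := @fatou _ _ _ mu _ measurableT (fun n x => `|f_ n x|%:E) mabs (fun _ _ _ => normr_ge0 _).
  have -> : (\int[mu]_x `|f x|%:E = \int[mu]_x limn_einf (fun n => `|f_ n x|%:E))%E.
    apply: ae_eq_integral => //; [exact/measurable_EFinP| |].
      by apply: measurableT_comp => //; apply: measurable_fun_limn_esup => n; exact: measurableT_comp.
    apply: filterS ff => x fx _; apply/esym.
    by apply: (cvg_limn_einf_sup _).1; apply: cvg_EFin; [exact: nearW|exact: cvg_norm].
  apply: le_trans h _; rewrite limn_einf_lim.
  have cE : (c_ n)%:E @[n --> \oo] --> c%:E by apply: cvg_EFin; [exact: nearW|].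
  rewrite -(cvg_lim _ cE)//; apply: lee_lim; first exact: is_cvg_einfs.
    by apply/cvg_ex; exists c%:E.
  apply: nearW => n; apply: (@le_trans _ _ (\int[mu]_x `|f_ n x|%:E)%E).
    by apply: ereal_inf_lbound; exists n => /=.
  rewrite (@ae_eq_integral _ _ _ _ setT (EFin \o f_ n))//; last 2 first.
  - exact/measurable_EFinP.
  - by apply: filterS (f0 n) => x fx _ /=; rewrite ger0_norm.
  by rewrite integrable_EFin_Rintegral// lee_fin.
have fi' : mu.-integrable setT (EFin \o f).
  by apply/integrableP; split; [exact/measurable_EFinP|exact: le_lt_trans fat (ltry _)].
split => //; rewrite -lee_fin -integrable_EFin_Rintegral//.
rewrite (@ae_eq_integral _ _ _ _ setT (fun x => `|f x|%:E))//.
- exact/measurable_EFinP.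
- exact/measurable_EFinP.
- by apply: filterS fge0 => x /= -> _.
Qed.
End ae_integration.

(** * Hilbert space structure *)

Section squot_dot.
Context (R : realType) (V : lmodType R) (q : semidot V).
Implicit Types x y z : squot q.

Lemma sdotB x y z : sdot (x - y) z = sdot x z - sdot y z.
Proof. by rewrite addrC -scaleN1r sdotDl mulN1r addrC. Qed.

Lemma sdotD x y z : sdot (x + y) z = sdot x z + sdot y z.
Proof. by rewrite -[x]scale1r sdotDl mul1r scale1r. Qed.

Lemma sdotZ a x z : sdot (a *: x) z = a * sdot x z.
Proof. by rewrite -[a *: x]addr0 sdotDl sdot0l addr0. Qed.

Lemma squot_normsq x : `|x| ^+ 2 = sdot x x.
Proof. by rewrite squot_normE sqr_sqrtr// sdot_ge0. Qed.

Lemma sdot_CauchySchwarz x y : `|sdot x y| <= `|x| * `|y|.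
Proof.
rewrite -ler_sqr ?nnegrE ?mulr_ge0// exprMn !squot_normsq real_normK ?num_real//.
by rewrite -[x]spi_repr -[y]spi_repr !sdot_spi dot_CauchySchwarz.
Qed.

Lemma sdot_cvgl (x_ : nat -> squot q) x y : x_ @ \oo --> x ->
  sdot (x_ n) y @[n --> \oo] --> sdot x y.
Proof.
move=> /cvgrPdist_le xx; apply/cvgrPdist_le => e e0.
move: xx => /(_ (e / (`|y| + 1))).
have y1 : 0 < `|y| + 1 by rewrite ltr_wpDl.
rewrite divr_gt0// => /(_ isT); apply: filterS => n h.
rewrite -sdotB (le_trans (sdot_CauchySchwarz _ _))//.
apply: le_trans (_ : _ <= e / (`|y| + 1) * (`|y| + 1)) _; last by rewrite divfK// gt_eqF.
by apply: ler_pM => //; rewrite lerDl.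
Qed.

Lemma squot_normsq_cvg (x_ : nat -> squot q) x : x_ @ \oo --> x ->
  sdot (x_ n) (x_ n) @[n --> \oo] --> sdot x x.
Proof.
move=> xx; under eq_fun do rewrite -squot_normsq; rewrite -squot_normsq.
by apply: (cvgM (f := fun n => `|x_ n|)); apply: cvg_norm.
Qed.

End squot_dot.

(** * Sequences with geometrically decaying increments *)

Section fast_sequences.
Context (R : realType).

Lemma cvg_sqr (a : nat -> R) (l : R) : a @ \oo --> l -> a n ^+ 2 @[n --> \oo] --> l ^+ 2.
Proof. by move=> al; under eq_cvg do rewrite expr2; rewrite expr2; exact: cvgM. Qed.

Lemma sum_half_le n : \sum_(0 <= i < n) (2 ^- i : R) <= 2.
Proof.
suff -> : \sum_(0 <= i < n) (2 ^- i : R) = 2 - 2 * 2 ^- n.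
  by rewrite lerBlDr lerDl mulr_ge0// invr_ge0 exprn_ge0.
elim: n => [|n ih]; first by rewrite big_nil expr0 invr1 mulr1 subrr.
rewrite big_nat_recr//= ih exprS invfM.
by field; rewrite expf_neq0.
Qed.

Lemma cvg_half (C : R) : C * 2 ^- n @[n --> \oo] --> (0 : R).
Proof.
rewrite -(mulr0 C); apply: cvgMr.
under eq_cvg do rewrite -exprVn; apply: cvg_expr.
by rewrite ger0_norm// invf_lt1// ltr1n.
Qed.

(** Telescoping against a geometric series. The explicit rate is kept because it later yields almost
    everywhere convergence of the whole sequence, without passing to subsequences. *)
Lemma fast_Cauchy_dist (V : normedModType R) (x_ : nat -> V) C : 0 <= C ->
  (forall n, `|x_ n.+1 - x_ n| <= C * 2 ^- n) ->
  forall n m, `|x_ (n + m)%N - x_ n| <= 2 * C * 2 ^- n.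
Proof.
move=> C0 xC n m; have C0n k : 0 <= C * 2 ^- k by rewrite mulr_ge0// invr_ge0 exprn_ge0.
suff h : `|x_ (n + m)%N - x_ n| <= C * 2 ^- n * \sum_(0 <= i < m) 2 ^- i.
  apply: (le_trans h); rewrite -[leRHS]mulrA [leRHS]mulrC.
  by rewrite ler_wpM2l// sum_half_le.
elim: m => [|m ih]; first by rewrite addn0 subrr normr0 big_nil mulr0.
rewrite big_nat_recr//= mulrDr addnS -[x_ _ - _](subrKA (x_ (n + m)%N)) addrC.
rewrite (le_trans (ler_normD _ _))// lerD// (le_trans (xC _))//.
by rewrite exprD invfM mulrA.
Qed.

Lemma cvg_of_fast_dist (V : normedModType R) (x_ : nat -> V) x C :
  (forall n, `|x_ n - x| <= C * 2 ^- n) -> x_ @ \oo --> x.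
Proof.
move=> xC; apply/cvgrPdistC_le => e e0.
have /cvgrPdist_le/(_ _ e0) := cvg_half C.
apply: filterS => n; rewrite sub0r normrN => h.
by rewrite (le_trans (xC n))// (le_trans (ler_norm _)).
Qed.

(** The increments are absolutely summable because |r| <= 2^n r^2 + 2^-n, which follows from (2^n
    |r| - 1/2)^2 >= 0. *)
Lemma cvg_of_weighted_squares (a : nat -> R) :
  (\sum_(n <oo) (2 ^+ n * (a n.+1 - a n) ^+ 2)%:E < +oo)%E -> cvgn a.
Proof.
pose h n := 2 ^+ n * (a n.+1 - a n) ^+ 2; rewrite -[X in (X < _)%E]/(\sum_(n <oo) (h n)%:E)%E => hoo.
have h0 n : 0 <= h n by rewrite /h mulr_ge0 ?sqr_ge0 ?exprn_ge0.
have [K hK] : exists K, forall n, \sum_(0 <= i < n) h i <= K.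
  exists (fine (\sum_(n <oo) (h n)%:E)%E) => n.
  rewrite -lee_fin fineK; last first.
    by rewrite ge0_fin_numE//; apply: nneseries_ge0 => i _ _; rewrite lee_fin.
  by rewrite -sumEFin; apply: nneseries_lim_ge => i _ _; rewrite lee_fin.
have dh n : `|a n.+1 - a n| <= h n + 2 ^- n.
  rewrite /h -[_ ^+ 2]real_normK ?num_real//; set d := `| _ |.
  have p : 0 < (2 ^+ n : R) by rewrite exprn_gt0.
  rewrite -(ler_pM2r p) mulrDl mulVf ?gt_eqF//.
  have := sqr_ge0 (2 ^+ n * d - 1 / 2); rewrite sqrrB => e.
  have -> : 2 ^+ n * d ^+ 2 * 2 ^+ n = (2 ^+ n * d) ^+ 2 by ring.
  by rewrite mulrC; lra.
have sa : cvgn (series (fun n => a n.+1 - a n)).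
  apply: normed_cvg; apply: nondecreasing_is_cvgn.
    by apply: nondecreasing_series => i _ _; exact: normr_ge0.
  exists (K + 2) => _ [n _ <-]; rewrite /series/=.
  apply: le_trans (lerD (hK n) (sum_half_le n)).
  by rewrite -big_split/=; apply: ler_sum => i _; exact: dh.
have -> : a = series (fun n => a n.+1 - a n) \+ cst (a 0%N).
  by apply/funext => n; rewrite /series/= telescope_sumr// subrK.
exact: is_cvgD sa (is_cvg_cst _).
Qed.

End fast_sequences.

(** * Completeness of L^2 and almost everywhere limits *)

Section L2_functions.
Context (R : realType) (d : nat) (Omega : set 'rV[R]_d) (oOmega : open Omega).
Local Notation mu := (leb oOmega).
Local Notation L2 := (L2 oOmega).
Implicit Types u v : L2.

Lemma L2_dotE u v : L2_dot u v = \int[mu]_x (u x * v x).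
Proof. by []. Qed.

Lemma L2_measurable u : measurable_fun setT u.
Proof. by have := LfunP (repr u) => /andP[]; rewrite inE. Qed.

Lemma L2_integrable_mul u v : mu.-integrable setT (EFin \o (fun x => u x * v x)).
Proof. exact: preL2_integrable. Qed.

Lemma L2_funB u v : {ae mu, forall x, (u - v : L2) x = u x - v x}.
Proof.
have := L2_funD (-1) v u; rewrite scaleN1r addrC.
by apply: filterS => x ->; rewrite mulN1r addrC.
Qed.

Lemma L2_funDr u v : {ae mu, forall x, (u + v : L2) x = u x + v x}.
Proof.
have := L2_funD 1 u v; rewrite scale1r.
by apply: filterS => x ->; rewrite mul1r.
Qed.

Lemma L2_normsqE u : `|u| ^+ 2 = \int[mu]_x (u x ^+ 2).
Proof. by rewrite squot_normsq. Qed.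

Lemma square_integrable_Lfun (f : 'rV[R]_d -> R) : measurable_fun setT f ->
  mu.-integrable setT (EFin \o (fun x => f x ^+ 2)) -> f \in Lfun mu 2%:E.
Proof.
move=> mf /integrableP[_ fi].
apply/andP; split; rewrite inE//=.
rewrite /finite_norm unlock /Lnorm poweR_lty//.
rewrite (eq_integral (fun x => (f x ^+ 2)%:E)) => [|x _]; last first.
  by rewrite -[`|_|%E]/(`|f x|%:E)%E poweR_EFin powR_mulrn// real_normK// num_real.
rewrite (eq_integral (fun x => (f x ^+ 2)%:E)) in fi => [//|x _].
by rewrite /= ger0_norm ?sqr_ge0.
Qed.

Lemma L2_of_square_integrable (f : 'rV[R]_d -> R) : measurable_fun setT f ->
  mu.-integrable setT (EFin \o (fun x => f x ^+ 2)) ->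
  exists u : L2, {ae mu, forall x, u x = f x}.
Proof.
move=> mf fi.
exists (spi _ (Lfun_Sub (lee1n 2) (square_integrable_Lfun mf fi) : preL2 oOmega)).
exact: L2_spi.
Qed.

(** The squared increments decay like 4^-n, so they remain summable after weighting with 2^n. The
    sum of the weighted squares is then integrable, hence finite almost everywhere, which forces
    pointwise convergence. *)
Lemma Riesz_Fischer (u_ : nat -> L2) C : 0 <= C ->
  (forall n, `|u_ n.+1 - u_ n| <= C * 2 ^- n) ->
  exists u, (forall n, `|u_ n - u| <= 2 * C * 2 ^- n) /\
    {ae mu, forall x, u_ n x @[n --> \oo] --> u x}.
Proof.
move=> C0 uC.
pose h n x := 2 ^+ n * (u_ n.+1 x - u_ n x) ^+ 2.
have mh n : measurable_fun setT (h n).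
  apply: measurable_funM => //; apply: measurable_funX.
  by apply: measurable_funB; exact: L2_measurable.
have h0 n x : 0 <= h n x by rewrite /h mulr_ge0 ?sqr_ge0 ?exprn_ge0.
have hC n : (\int[mu]_x (h n x)%:E <= (C ^+ 2 * 2 ^- n)%:E)%E.
  have msq : measurable_fun setT (fun x => (u_ n.+1 - u_ n : L2) x ^+ 2).
    by apply: measurable_funX; exact: L2_measurable.
  rewrite (@ae_eq_integral _ _ _ _ setT (EFin \o (fun x => 2 ^+ n * (u_ n.+1 - u_ n : L2) x ^+ 2)))//; last 3 first.
  - exact/measurable_EFinP.
  - by apply/measurable_EFinP; apply: measurable_funM.
  - by apply: filterS (L2_funB (u_ n.+1) (u_ n)) => x /= -> _.
  have := L2_integrable_mul (u_ n.+1 - u_ n) (u_ n.+1 - u_ n) => di.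
  rewrite integrable_EFin_Rintegral; last first.
    under [X in _.-integrable _ X]eq_fun do rewrite /= EFinM.
    exact: integrableZl.
  rewrite RintegralZl// -L2_normsqE lee_fin.
  have p : 0 < (2 ^+ n : R) by rewrite exprn_gt0.
  rewrite -ler_pdivlMl//.
  apply: (@le_trans _ _ ((C * 2 ^- n) ^+ 2)).
    by rewrite ler_sqr ?nnegrE ?normr_ge0 ?uC// mulr_ge0// invr_ge0 ltW.
  by rewrite exprMn mulrCA ler_wpM2l ?sqr_ge0// expr2.
have cu : {ae mu, forall x, cvgn (u_ ^~ x)}.
  have hoo : (\int[mu]_x (\sum_(n <oo) (h n x)%:E) < +oo)%E.
    rewrite integral_nneseries//; last 2 first.
      by move=> n; exact/measurable_EFinP.
      by move=> n x _; rewrite lee_fin.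
    apply: (@le_lt_trans _ _ (C ^+ 2 * 2)%:E); last exact: ltry.
    apply: lime_le.
      by apply: is_cvg_nneseries => n _ _; apply: integral_ge0 => x _; rewrite lee_fin.
    apply: nearW => n; apply: (@le_trans _ _ (\sum_(0 <= i < n) (C ^+ 2 * 2 ^- i)%:E)%E).
      by apply: lee_sum => i _; exact: hC.
    by rewrite sumEFin lee_fin -mulr_sumr ler_wpM2l ?sqr_ge0// sum_half_le.
  have hi : mu.-integrable setT (fun x => \sum_(n <oo) (h n x)%:E)%E.
    apply/integrableP; split.
      apply: ge0_emeasurable_sum => [n x _ _|n _]; first by rewrite lee_fin.
      exact/measurable_EFinP.
    rewrite (eq_integral (fun x => \sum_(n <oo) (h n x)%:E)%E)// => x _.
    by rewrite gee0_abs// nneseries_ge0// => n _ _; rewrite lee_fin.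
  apply: filterS (integrable_ae measurableT hi) => x /(_ I) hx.
  apply: cvg_of_weighted_squares; rewrite -ge0_fin_numE//.
  by apply: nneseries_ge0 => n _ _; rewrite lee_fin h0.
(* The upper limit is measurable and equals the limit wherever that exists; [fine] sends infinite
   values to 0, which happens only on a null set. *)
pose f x := fine (limn_esup (fun n => (u_ n x)%:E)).
have mf : measurable_fun setT f.
  apply: measurableT_comp => //; apply: measurable_fun_limn_esup => n.
  by apply/measurable_EFinP; exact: L2_measurable.
have uf : {ae mu, forall x, u_ n x @[n --> \oo] --> f x}.
  apply: filterS cu => x /cvg_ex[l ul].
  suff -> : f x = l by [].
  have ulE : (u_ n x)%:E @[n --> \oo] --> l%:E by apply: cvg_EFin => //; exact: nearW.
  by rewrite /f (cvg_limn_einf_sup ulE).2.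
(* Fatou's lemma in m for the squares of u_(n+m) - u_n, whose integrals are bounded by the geometric
   tail. *)
have key n : mu.-integrable setT (EFin \o (fun x => (f x - u_ n x) ^+ 2)) /\
    \int[mu]_x (f x - u_ n x) ^+ 2 <= (2 * C * 2 ^- n) ^+ 2.
  have msq (v : L2) : measurable_fun setT (fun x => v x ^+ 2).
    by apply: measurable_funX; exact: L2_measurable.
  apply: (@fatou_ae _ _ _ _ (fun m x => (u_ (n + m)%N - u_ n : L2) x ^+ 2) _ (fun _ => (2 * C * 2 ^- n) ^+ 2)).
  - by move=> m; exact: L2_integrable_mul.
  - by apply: measurable_funX; apply: measurable_funB => //; exact: L2_measurable.
  - by move=> m; apply: aeW => x; rewrite sqr_ge0.
  - have := @ae_foralln _ _ _ mu _ (fun m => L2_funB (u_ (n + m)%N) (u_ n)).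
    move: uf; apply: filterS2 => x ufx e.
    under eq_fun do rewrite e; apply: cvg_sqr; apply: cvgB; last exact: cvg_cst.
    by under eq_fun do rewrite addnC; rewrite -(cvg_shiftn n) in ufx.
  - move=> m; rewrite -L2_normsqE ler_sqr ?nnegrE ?normr_ge0 ?fast_Cauchy_dist//.
    by rewrite !mulr_ge0// invr_ge0 exprn_ge0.
  - exact: cvg_cst.
have mfu n : measurable_fun setT (fun x => f x - u_ n x).
  by apply: measurable_funB => //; exact: L2_measurable.
(* The square integrable function at hand is f - u_0, not f; it is represented in L^2 and u_0 is
   added back. *)
have [v vE] := L2_of_square_integrable (mfu 0%N) (key 0%N).1.
have uE : {ae mu, forall x, (v + u_ 0%N : L2) x = f x}.
  by apply: filterS2 vE (L2_funDr v (u_ 0%N)) => x -> ->; rewrite subrK.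
exists (v + u_ 0%N); split; last by apply: filterS2 uE uf => x ->.
move=> n; rewrite -ler_sqr ?nnegrE ?normr_ge0//; last first.
  by rewrite !mulr_ge0// invr_ge0 exprn_ge0.
rewrite distrC L2_normsqE; apply: le_trans (key n).2.
rewrite le_eqVlt; apply/orP; left; apply/eqP; apply: ae_eq_Rintegral.
- by apply: measurable_funX; exact: L2_measurable.
- exact: measurable_funX.
- by apply: filterS2 uE (L2_funB (v + u_ 0%N) (u_ n)) => x -> ->.
Qed.

End L2_functions.

(** * Products of test functions with a coordinate *)

Section coordinate_test_functions.
Context (R : realType) (d : nat) (i : 'I_d).
Implicit Types phi psi : 'rV[R]_d -> R.

Let coord (x : 'rV[R]_d) : R := x 0 i.

Let is_derive_coord x v : is_derive x v coord (coord v).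
Proof.
have h : (fun h => h^-1 *: ((coord \o shift x) (h *: v) - coord x)) @ 0^' --> coord v.
  apply: cvg_near_cst; near=> h => /=.
  have h0 : h != 0 by near: h; exact: nbhs_dnbhs_neq.
  by rewrite /coord !mxE addrK [_ *: _]mulrA mulVf// mul1r.
by apply: DeriveDef; [apply/cvg_ex; eexists; exact: h|exact/cvg_lim].
Unshelve. all: by end_near. Qed.

(** Differentiating x_i phi produces an extra term without the factor x_i. Sums x_i phi + psi with
    smooth phi and psi are stable under partial derivatives, which permits induction over iterated
    ones. *)
Let coord_muladd phi psi : 'rV[R]_d -> R := coord \* phi \+ psi.

Let derivable_smooth phi x j : smooth phi -> derivable phi x (delta_mx 0 j).
Proof. by move=> /(_ [::])[_]. Qed.

Let derivable_coord x v : derivable coord x v.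
Proof. by have [] := is_derive_coord x v. Qed.

Let partial_coord_muladd j phi psi : smooth phi -> smooth psi ->
  partial j (coord_muladd phi psi) =
  coord_muladd (partial j phi) (coord (delta_mx 0 j) \*: phi \+ partial j psi).
Proof.
move=> sphi spsi; apply/funext => x; rewrite /partial /coord_muladd.
have dphi : derivable phi x (delta_mx 0 j) by exact: derivable_smooth.
have dpsi : derivable psi x (delta_mx 0 j) by exact: derivable_smooth.
have dc : derivable coord x (delta_mx 0 j) by exact: derivable_coord.
have [_ Dc] := is_derive_coord x (delta_mx 0 j).
have -> : 'D_(delta_mx 0 j) (coord \* phi \+ psi) x =
    'D_(delta_mx 0 j) (coord * phi : _ -> R) x + 'D_(delta_mx 0 j) psi x.
  exact: (deriveD (derivableM dc dphi) dpsi).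
rewrite (deriveM dc dphi) Dc.
by rewrite /= addrA [X in _ + X + _]mulrC.
Qed.

Lemma smooth_coord_muladd phi psi : smooth phi -> smooth psi ->
  smooth (coord_muladd phi psi).
Proof.
move=> sphi spsi s.
have [phi' [psi' [sphi' spsi' ->]]] : exists phi' psi',
    [/\ smooth phi', smooth psi' &
       iter_partial s (coord_muladd phi psi) = coord_muladd phi' psi'].
  elim: s => [|j s [phi' [psi' [sphi' spsi' /= ->]]]]; first by exists phi, psi.
  exists (partial j phi'), (coord (delta_mx 0 j) \*: phi' \+ partial j psi').
  split; [exact: smooth_partial| |exact: partial_coord_muladd].
  exact: (smoothP _ sphi' (smooth_partial j spsi')).
split=> [x|j x].
  apply: continuousD; last exact: (spsi' [::]).1.
  by apply: continuousM; [exact: coord_continuous|exact: (sphi' [::]).1].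
apply: derivableD; last exact: derivable_smooth.
by apply: derivableM => //; exact: derivable_smooth.
Qed.

Lemma test_function_coord_mul Omega phi : test_function Omega phi ->
  test_function Omega (fun x : 'rV[R]_d => x 0 i * phi x).
Proof.
move=> [sphi [K [cK KO K0]]].
have e : (fun x : 'rV[R]_d => x 0 i * phi x) = coord_muladd phi (cst 0).
  by apply/funext => x; rewrite /coord_muladd/= addr0.
split; first by rewrite e; apply: smooth_coord_muladd => //; have [] := test_function0 Omega.
by exists K; split => // x /K0 ->; rewrite mulr0.
Qed.

Lemma partial_coord_mul phi x : smooth phi ->
  partial i (fun x : 'rV[R]_d => x 0 i * phi x) x = phi x + x 0 i * partial i phi x.
Proof.
move=> sphi; have e : (fun x : 'rV[R]_d => x 0 i * phi x) = coord_muladd phi (cst 0).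
  by apply/funext => y; rewrite /coord_muladd/= addr0.
have s0 : smooth (cst 0 : 'rV[R]_d -> R) by have [] := test_function0 (setT : set 'rV[R]_d).
rewrite e partial_coord_muladd// /coord_muladd/= /coord mxE !eqxx.
by rewrite /partial derive_cst addr0 [_ *: _]mul1r addrC.
Qed.

End coordinate_test_functions.

(** * Poincare's inequality on a bounded domain *)

Section Poincare.
Context (R : realType) (d : nat) (Omega : set 'rV[R]_d) (oOmega : open Omega).
Hypothesis bOmega : bounded_set Omega.
Local Notation mu := (leb oOmega).
Local Notation L2 := (L2 oOmega).
Local Notation preH1 := (preH1 oOmega).
Local Notation preH01 := (preH01 oOmega).

Lemma leb_ae : {ae mu, forall x, Omega x}.
Proof.
have mO := open_measurable_rV oOmega.
exists (~` Omega); split => //; first exact: measurableC.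
by rewrite /leb /= /mrestr setICl measure0.
Qed.

Lemma bounded_set_box : exists2 M, 0 <= M & Omega `<=` box M.
Proof.
have [M [_ MP]] := bOmega; exists (Num.max 0 (M + 1)); first by rewrite le_max lexx.
move=> x Ox i; apply: (@le_trans _ _ `|x|).
  rewrite [leRHS]mx_normrE; exact: (le_bigmax _ (fun ij => `|x ij.1 ij.2|) (0, i)).
by apply: MP => //; rewrite lt_max ltrDl ltr01 orbT.
Qed.

Lemma leb_integrable_cst (c : R) : mu.-integrable setT (EFin \o (fun=> c)).
Proof.
have [M M0 OM] := bounded_set_box.
apply/integrableP; split; first exact/measurable_EFinP.
rewrite (eq_integral (fun=> `|c|%:E))// integral_cst//.
apply: lte_mul_pinfty; [by rewrite lee_fin|by []|].
apply: le_lt_trans (lebesgue_rV_box d M).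
rewrite /leb /= /mrestr setTI; apply: le_measure; rewrite ?inE//.
- exact: open_measurable_rV.
- exact: measurable_box.
Qed.

Definition L2_test phi (tphi : test_function Omega phi) : L2 := spi _ (preL2_test oOmega tphi).

Lemma L2_test_ae phi (tphi : test_function Omega phi) :
  {ae mu, forall x, L2_test tphi x = phi x}.
Proof. exact: L2_spi. Qed.

Lemma L2_dot_test (u : L2) phi (tphi : test_function Omega phi) :
  \int[mu]_x (u x * phi x) = L2_dot u (L2_test tphi).
Proof. by rewrite -[u in RHS]spi_repr /L2_dot sdot_spi. Qed.

Let coord_mulL2 (i : 'I_d) M : 0 <= M -> Omega `<=` box M -> forall v : L2, exists v' : L2,
  {ae mu, forall x, v' x = x 0 i * v x} /\ `|v'| <= M * `|v|.
Proof.
(* The indicator restricts x_i to Omega, where it is bounded by M; this changes nothing almost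
   everywhere, as [leb] carries no mass outside Omega. *)
move=> M0 OM v; pose f x := \1_Omega x * x 0 i * v x.
have mO := open_measurable_rV oOmega.
have fM x : `|f x ^+ 2| <= M ^+ 2 * v x ^+ 2.
  rewrite ger0_norm ?sqr_ge0// /f exprMn ler_wpM2r ?sqr_ge0// indicE.
  have [xO|xO] := boolP (x \in Omega); last by rewrite mul0r expr0n sqr_ge0.
  rewrite mul1r -[leLHS]real_normK ?num_real// ler_sqr ?nnegrE//.
  by apply: OM; exact: set_mem.
have mf : measurable_fun setT f.
  apply: measurable_funM; last exact: L2_measurable.
  by apply: measurable_funM; [exact: measurable_indic|exact: measurable_coord].
have mf2 : measurable_fun setT (fun x => f x ^+ 2) by exact: measurable_funX.
have vi : mu.-integrable setT (EFin \o (fun x => M ^+ 2 * v x ^+ 2)).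
  under [X in _.-integrable _ X]eq_fun do rewrite /= EFinM.
  by apply: integrableZl => //; exact: (L2_integrable_mul v v).
have fi := integrable_le_abs mf2 fM vi.
have [v' v'E] := L2_of_square_integrable mf fi.
exists v'; split.
  by apply: filterS2 v'E leb_ae => x -> Ox; rewrite /f indicE mem_set// mul1r.
rewrite -ler_sqr ?nnegrE ?mulr_ge0// exprMn !L2_normsqE.
rewrite -RintegralZl//; last exact: (L2_integrable_mul v v).
rewrite (@ae_eq_Rintegral _ _ _ _ _ (fun x => f x ^+ 2))//.
- apply: le_Rintegral => // x _; apply: le_trans (fM x); exact: ler_norm.
- by apply: measurable_funX; exact: L2_measurable.
- by apply: filterS v'E => x ->.
Qed.

(* A test function phi approximating w1 yields the test function x_i phi, and the weak
   derivative of w1 against it gives |w1|^2 = - 2 \int x_i w1 (d_i w1) in the limit. *)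
Lemma Poincare_H1 (i : 'I_d) M : 0 <= M -> Omega `<=` box M ->
  forall w : preH1, w \in @in_H01 _ _ _ oOmega -> `|w.1| <= 2 * M * `|w.2 i|.
Proof.
move=> M0 OM w; rewrite inE => -[H1w apx].
have [Xw [XwE _]] := coord_mulL2 i M0 OM w.1.
have [Xg [XgE Xgle]] := coord_mulL2 i M0 OM (w.2 i).
have sym : L2_dot Xw (w.2 i) = L2_dot Xg w.1.
  rewrite !L2_dotE; apply: ae_eq_Rintegral.
  - by apply: measurable_funM; exact: L2_measurable.
  - by apply: measurable_funM; exact: L2_measurable.
  - by apply: filterS2 XwE XgE => x -> ->; ring.
have e1 n : 0 < (2 ^- n : R) by rewrite invr_gt0 exprn_gt0.
have /choice[w_ w_P] : forall n, exists w' : preH1, is_test w' /\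
    (`|w'.1 - w.1| <= 1 * 2 ^- n /\ `|w'.2 i - w.2 i| <= 1 * 2 ^- n).
  move=> n; have [w' tw' [h1 h2]] := apx _ (e1 n); exists w'; split => //.
  by rewrite mul1r distrC ltW// distrC ltW.
have c1 : (w_ n).1 @[n --> \oo] --> w.1.
  by apply: (@cvg_of_fast_dist _ _ _ _ 1) => n; have [_ []] := w_P n.
have c2 : (w_ n).2 i @[n --> \oo] --> w.2 i.
  by apply: (@cvg_of_fast_dist _ _ _ _ 1) => n; have [_ []] := w_P n.
(* The weak derivative of w1 tested with x_i phi, where d_i (x_i phi) = phi + x_i d_i phi. Every
   term is linear in the approximant, so L^2 convergence is enough to pass to the limit. *)
have eqn n : sdot ((w_ n).2 i) Xw + sdot (w_ n).1 w.1 + sdot (w_ n).1 Xg = 0.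
  have [[phi tphi [E1 E2]] _] := w_P n.
  have tX := test_function_coord_mul i tphi.
  have := H1w i _ tX => H.
  have X1 : \int[mu]_x (w.2 i x * (x 0 i * phi x)) = L2_dot Xg (w_ n).1.
    rewrite (L2_dot_test _ tX) !L2_dotE; apply: ae_eq_Rintegral.
    - by apply: measurable_funM; exact: L2_measurable.
    - by apply: measurable_funM; exact: L2_measurable.
    - by apply: filterS3 (L2_test_ae tX) XgE E1 => x -> -> ->; ring.
  have tX' := test_function_partial i tX.
  have X2 : \int[mu]_x (w.1 x * partial i (fun x : 'rV[R]_d => x 0 i * phi x) x) =
      L2_dot ((w_ n).2 i) Xw + L2_dot (w_ n).1 w.1.
    rewrite (L2_dot_test _ tX') !L2_dotE -RintegralD//; last 2 first.
      exact: L2_integrable_mul.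
      exact: L2_integrable_mul.
    apply: ae_eq_Rintegral.
    - by apply: measurable_funM; exact: L2_measurable.
    - by apply: measurable_funD; apply: measurable_funM; exact: L2_measurable.
    - have E : {ae mu, forall x, L2_test tX' x = partial i (fun x : 'rV[R]_d => x 0 i * phi x) x
          /\ Xw x = x 0 i * w.1 x} by apply: filterS2 (L2_test_ae tX') XwE => x -> ->.
      apply: filterS3 E E1 (E2 i) => x [-> ->] -> ->.
      by rewrite partial_coord_mul; [ring|exact: tphi.1].
  by rewrite -/(L2_dot _ _) -/(L2_dot _ w.1) -X2 H X1 sdotC addNr.
have lim : sdot (w.2 i) Xw + sdot w.1 w.1 + sdot w.1 Xg = 0.
  have l : sdot ((w_ n).2 i) Xw + sdot (w_ n).1 w.1 + sdot (w_ n).1 Xg @[n --> \oo] -->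
      sdot (w.2 i) Xw + sdot w.1 w.1 + sdot w.1 Xg.
    by apply: cvgD; [apply: cvgD|]; exact: sdot_cvgl.
  by rewrite -(cvg_lim _ l)//; under eq_fun do rewrite eqn; rewrite lim_cst.
have [w0|w0] := eqVneq `|w.1| 0; first by rewrite w0 !mulr_ge0.
have wp : 0 < `|w.1| by rewrite lt_neqAle eq_sym w0 normr_ge0.
rewrite -(ler_pM2r wp) -expr2 squot_normsq.
have -> : sdot w.1 w.1 = - (2 * sdot Xg w.1).
  apply/eqP; rewrite -subr_eq0 opprK -lim; apply/eqP.
  rewrite (sdotC (w.2 i)) [sdot Xw _]sym -/(sdot _ _) (sdotC w.1 Xg) /L2_dot; ring.
rewrite -mulrN -!mulrA ler_wpM2l// (le_trans (ler_norm _))// normrN.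
rewrite (le_trans (sdot_CauchySchwarz _ _))// mulrA ler_wpM2r//.
Qed.

End Poincare.

(** * H^1_0 as a complete space of functions *)

Section H01_structure.
Context (R : realType) (d : nat) (d_gt0 : (0 < d)%N).
Context (Omega : set 'rV[R]_d) (oOmega : open Omega) (bOmega : bounded_set Omega).
Local Notation mu := (leb oOmega).
Local Notation L2 := (L2 oOmega).
Local Notation H01 := (H01 oOmega).
Local Notation preH01 := (preH01 oOmega).
Local Notation p := (seminorm (H01_semidot oOmega)).

Lemma grad_le_seminorm (w : preH01) i : `|(val w).2 i| <= p w.
Proof.
rewrite -ler_sqr ?nnegrE ?normr_ge0 ?seminorm_ge0// squot_normsq.
rewrite /seminorm sqr_sqrtr ?dot_ge0// /= /grad_dot (bigD1 i)//= lerDl.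
by apply: sumr_ge0 => j _; exact: sdot_ge0.
Qed.

Lemma Poincare : exists2 C, 0 <= C & forall w : preH01, `|(val w).1| <= C * p w.
Proof.
have [M M0 OM] := bounded_set_box bOmega.
exists (2 * M); first by rewrite mulr_ge0.
move=> w; have i : 'I_d := Ordinal d_gt0.
apply: le_trans (Poincare_H1 i M0 OM (valP w)) _.
by rewrite ler_wpM2l ?mulr_ge0// grad_le_seminorm.
Qed.

(** By Poincare's inequality two elements with the same class have the same L^2 component, so the
    choice of representative inside [H01_L2] is harmless. *)
Lemma H01_L2_spi (w : preH01) : H01_L2 (spi _ w) = (val w).1.
Proof.
have [C C0 PC] := Poincare.
have /eqP/spi_eqP e := spi_repr (spi (H01_semidot oOmega) w).
apply/eqP; rewrite -subr_eq0 -normr_eq0 eq_le normr_ge0 andbT.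
by have := PC (repr (spi (H01_semidot oOmega) w) - w); rewrite e mulr0.
Qed.

Lemma H01_L2D a (v w : H01) : H01_L2 (a *: v + w) = a *: H01_L2 v + H01_L2 w.
Proof.
have -> : a *: v + w = spi _ (a *: (repr v : preH01) + repr w).
  by rewrite spiD -[w in LHS]spi_repr.
by rewrite H01_L2_spi.
Qed.

Lemma H01_L2_bounded : exists2 C, 0 <= C & forall v : H01, `|H01_L2 v| <= C * `|v|.
Proof.
have [C C0 PC] := Poincare; exists C => // v.
by rewrite -[v]spi_repr H01_L2_spi (le_trans (PC _))// [`|_|]snorm_spi.
Qed.

Lemma H01_L2Z a (v : H01) : H01_L2 (a *: v) = a *: H01_L2 v.
Proof.
have H0 : H01_L2 (0 : H01) = 0.
  have := H01_L2D (-1) 0 (0 : H01); rewrite scaler0 addr0 => ->.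
  by rewrite scaleN1r addNr.
by rewrite -[a *: v]addr0 H01_L2D H0 addr0.
Qed.

Lemma H01_L2B (v w : H01) : H01_L2 (v - w) = H01_L2 v - H01_L2 w.
Proof. by rewrite addrC -scaleN1r H01_L2D scaleN1r addrC. Qed.

Lemma H01_funD a (v w : H01) : {ae mu, forall x, (a *: v + w : H01) x = a * v x + w x}.
Proof. by have := L2_funD a (v : L2) (w : L2); rewrite -H01_L2D. Qed.

Lemma H01_funB (v w : H01) : {ae mu, forall x, (v - w : H01) x = v x - w x}.
Proof. by have := L2_funB (v : L2) (w : L2); rewrite -H01_L2B. Qed.

Lemma H01_funZ a (v : H01) : {ae mu, forall x, (a *: v : H01) x = a * v x}.
Proof.
have := L2_funD a (v : L2) 0; rewrite addr0 -H01_L2Z.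
have := L2_funB (v : L2) v; rewrite subrr.
by apply: filterS2 => x -> ->; rewrite subrr addr0.
Qed.

Lemma H01_measurable (v : H01) : measurable_fun setT v.
Proof. exact: L2_measurable. Qed.

(** The function and each gradient component converge in L^2 at a geometric rate. Weak derivatives
    pass to the limit, being identities between inner products with fixed test functions. *)
Lemma H01_complete (v_ : nat -> H01) C : 0 <= C ->
  (forall n, `|v_ n.+1 - v_ n| <= C * 2 ^- n) ->
  exists v : H01, exists K, (forall n, `|v_ n - v| <= K * 2 ^- n) /\
    {ae mu, forall x, v_ n x @[n --> \oo] --> v x}.
Proof.
move=> C0 vC; pose w_ n : preH01 := repr (v_ n).
have dw n : p (w_ n.+1 - w_ n) <= C * 2 ^- n.
  rewrite -[p _]snorm_spi; apply: le_trans (vC n).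
  rewrite le_eqVlt; apply/orP; left; apply/eqP; congr snorm.
  rewrite -[in RHS](spi_repr (v_ n.+1)) -[in RHS](spi_repr (v_ n)).
  by rewrite -[- spi _ _]scaleN1r -[-1 *: spi _ _]spiZ -spiD scaleN1r.
have [P P0 PP] := Poincare.
have [u [uC uae]] : exists u : L2, (forall n, `|(val (w_ n)).1 - u| <= 2 * (P * C) * 2 ^- n) /\
    {ae mu, forall x, (val (w_ n)).1 x @[n --> \oo] --> u x}.
  apply: Riesz_Fischer; first by rewrite mulr_ge0.
  move=> n; apply: le_trans (PP (w_ n.+1 - w_ n)) _.
  by rewrite -mulrA ler_wpM2l.
have /choice[g gC] : forall i : 'I_d, exists g : L2, forall n,
    `|(val (w_ n)).2 i - g| <= 2 * C * 2 ^- n.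
  move=> i; have [||g [gC _]] := @Riesz_Fischer _ _ _ oOmega (fun n => (val (w_ n)).2 i) C => //.
    move=> n; apply: le_trans (dw n).
    have := grad_le_seminorm (w_ n.+1 - w_ n) i.
    by rewrite /= !ffunE.
  by exists g.
pose w : preH1 oOmega := (u, finfun g).
have wH01 : w \in @in_H01 _ _ _ oOmega.
  rewrite inE; split.
    move=> i phi tphi; have tp := test_function_partial i tphi.
    rewrite /= ffunE (L2_dot_test _ tphi) (L2_dot_test _ tp).
    have c1 : L2_dot (val (w_ n)).1 (L2_test oOmega tp) @[n --> \oo] --> L2_dot u (L2_test oOmega tp).
      by apply: sdot_cvgl; exact: cvg_of_fast_dist uC.
    have c2 : L2_dot ((val (w_ n)).2 i) (L2_test oOmega tphi) @[n --> \oo] --> L2_dot (g i) (L2_test oOmega tphi).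
      by apply: sdot_cvgl; exact: cvg_of_fast_dist (gC i).
    have e n : L2_dot (val (w_ n)).1 (L2_test oOmega tp) = - L2_dot ((val (w_ n)).2 i) (L2_test oOmega tphi).
      rewrite -!L2_dot_test; have := valP (w_ n); rewrite inE => -[H _]; exact: H.
    rewrite -(cvg_lim _ c1)//; under eq_fun do rewrite e.
    by apply/cvg_lim => //; exact: cvgN.
  move=> e e0.
  (* A closure is closed: some w_n is within e/2 of the limit in every component, and a test
     function is within e/2 of that w_n. *)
  have e20 : 0 < e / 2 by rewrite divr_gt0.
  have [n h1 h2] : exists2 n, `|(val (w_ n)).1 - u| <= e / 2 &
      2 * C * 2 ^- n <= e / 2.
    have /cvgrPdistC_le/(_ _ e20) c1 := cvg_of_fast_dist uC.
    have /cvgrPdistC_le/(_ _ e20) c2 := cvg_half (2 * C).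
    have [n _ /(_ n (leqnn n))[h1 h2]] := filterI c1 c2.
    by exists n => //; move: h2; rewrite subr0; apply: le_trans; exact: ler_norm.
  have := valP (w_ n); rewrite inE => -[_ /(_ _ e20)[w' tw' [k1 k2]]].
  exists w' => //; split => [|i].
    rewrite -[_ - _](subrKA (val (w_ n)).1) (le_lt_trans (ler_normD _ _))//.
    by rewrite (splitr e) ler_ltD// distrC.
  rewrite -[_ - _](subrKA ((val (w_ n)).2 i)) (le_lt_trans (ler_normD _ _))//.
  by rewrite (splitr e) ler_ltD// distrC /= ffunE (le_trans (gC i n)).
pose v : H01 := spi _ (PreH01 wH01).
(* The squared norm is a sum of d squares, each at most (2 C 2^-n)^2, and d <= d^2. *)
exists v, (d%:R * (2 * C)); split; last first.
  by rewrite /v; have := H01_L2_spi (PreH01 wH01) => /= ->.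
move=> n; have -> : v_ n - v = spi _ (w_ n - PreH01 wH01).
  rewrite -[v_ n](spi_repr (v_ n)) /v -[- spi _ _]scaleN1r -[-1 *: spi _ _]spiZ -spiD.
  by rewrite scaleN1r.
rewrite [`|_|]snorm_spi.
have Cn : 0 <= 2 * C * 2 ^- n by rewrite !mulr_ge0// invr_ge0 exprn_ge0.
have -> : d%:R * (2 * C) * 2 ^- n = d%:R * (2 * C * 2 ^- n) by ring.
rewrite -ler_sqr ?nnegrE ?seminorm_ge0 ?mulr_ge0// [in leRHS]exprMn.
rewrite /seminorm sqr_sqrtr ?dot_ge0// /= /grad_dot.
apply: (@le_trans _ _ (\sum_(i < d) (2 * C * 2 ^- n) ^+ 2)).
  apply: ler_sum => i _; rewrite /L2_dot -squot_normsq ler_sqr ?nnegrE//.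
  by have := gC i n; rewrite /= !ffunE.
rewrite sumr_const card_ord -[_ *+ d]mulr_natl.
by rewrite ler_wpM2r ?sqr_ge0// -natrX ler_nat -{1}(muln1 d) -mulnn leq_mul2l d_gt0 orbT.
Qed.

End H01_structure.

(** * The weighted space and the adjoint equation *)

Section weighted_space.
Context (R : realType) (d : nat) (d_gt0 : (0 < d)%N).
Context (Omega : set 'rV[R]_d) (oOmega : open Omega) (bOmega : bounded_set Omega).
Context (alpha : R) (alpha_gt0 : 0 < alpha) (alpha_lt1 : alpha < 1).
Local Notation mu := (leb oOmega).
Local Notation H01 := (H01 oOmega).
Variable y : H01.
Local Notation V := (Vspace alpha y).
Local Notation wt x := (weight alpha (y x)).
Implicit Types u v z : H01.

Definition weighted_dot v z : R := \int[mu]_x (v x * z x * wt x).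

Lemma measurable_wt : measurable_fun setT (fun x => wt x).
Proof.
by apply: (measurableT_comp (@measurable_weight R alpha)); exact: H01_measurable.
Qed.

Let neq0_restrict (f : 'rV[R]_d -> R) :
  (fun x => f x / `|y x| `^ (1 - alpha)) \_ [set x | y x != 0] = fun x => f x * wt x.
Proof.
apply/funext => x; rewrite patchE; case: ifPn => //.
rewrite notin_setE /= => /negP; rewrite negbK => /eqP ->.
by rewrite weight0// mulr0.
Qed.

Lemma lin_formE v z : lin_form alpha y v z = H01_dot v z + alpha * weighted_dot v z.
Proof. by rewrite /lin_form Rintegral_mkcond neq0_restrict. Qed.

Let measurable_mul_wt (v z : H01) : measurable_fun setT (fun x => v x * z x * wt x).
Proof.
by apply: measurable_funM; [apply: measurable_funM; exact: H01_measurable|exact: measurable_wt].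
Qed.

Lemma VspaceP v : V v <->
  mu.-integrable setT (EFin \o (fun x => v x * v x * wt x)) /\
  {ae mu, forall x, y x = 0 -> v x = 0}.
Proof.
have e : (\int[mu]_(x in [set x | y x != 0%R]) (v x ^+ 2 / `|y x| `^ (1 - alpha))%:E =
    \int[mu]_x (v x * v x * wt x)%:E)%E.
  rewrite integral_mkcond; apply: eq_integral => x _.
  have := congr1 (fun f => f x) (neq0_restrict (fun x => v x ^+ 2)).
  rewrite !patchE; case: ifPn => _; first by rewrite /= expr2 => ->.
  by rewrite -expr2 => <-.
rewrite /Vspace/= e; split=> -[h ae0]; split => //.
  apply: integrable_finite => // x; by rewrite mulr_ge0 ?weight_ge0// -expr2 sqr_ge0.
by rewrite integrable_EFin_Rintegral// ltry.
Qed.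

Let square_wt_ge0 v x : 0 <= v x * v x * wt x.
Proof. by rewrite mulr_ge0 ?weight_ge0// -expr2 sqr_ge0. Qed.

(** The pointwise bound |v z| <= v^2 + z^2 under the weight. *)
Lemma weighted_integrable v z : V v -> V z ->
  mu.-integrable setT (EFin \o (fun x => v x * z x * wt x)).
Proof.
move=> /VspaceP[vi _] /VspaceP[zi _].
apply: (@integrable_le_abs _ _ _ _ _ (fun x => v x * v x * wt x + z x * z x * wt x)) => //.
  move=> x; rewrite normrM (ger0_norm (weight_ge0 _ _)) -mulrDl ler_wpM2r ?weight_ge0//.
  rewrite normrM -!expr2 -(real_normK (num_real (v x))) -(real_normK (num_real (z x))).
  have := sqr_ge0 (`|v x| - `|z x|); rewrite sqrrB; have := sqr_ge0 `|v x|; have := sqr_ge0 `|z x|.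
  lra.
exact: integrable_EFinD.
Qed.

Lemma VspaceD a v z : V v -> V z -> V (a *: v + z).
Proof.
move=> Vv Vz; have vz := weighted_integrable Vv Vz.
move: (Vv) (Vz) => /VspaceP[vi v0] /VspaceP[zi z0]; apply/VspaceP; split; last first.
  by apply: filterS3 v0 z0 (H01_funD d_gt0 bOmega a v z) => x h1 h2 -> yx; rewrite h1// h2// mulr0 addr0.
apply: (@ae_eq_integrable _ _ _ _ _ (fun x => a * (a * (v x * v x * wt x)) +
   (2 * a * (v x * z x * wt x) + z x * z x * wt x))) => //.
  by apply: filterS (H01_funD d_gt0 bOmega a v z) => x ->; ring.
apply: integrable_EFinD; first by do 2 apply: integrable_EFinZ.
by apply: integrable_EFinD => //; exact: integrable_EFinZ.
Qed.

Lemma Vspace0 : V 0.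
Proof.
have z0 : {ae mu, forall x, (0 : H01) x = 0}.
  by have := H01_funB d_gt0 bOmega y y; rewrite subrr; apply: filterS => x ->; rewrite subrr.
apply/VspaceP; split; last by apply: filterS z0 => x ->.
apply: (@ae_eq_integrable _ _ _ _ _ (fun=> 0)) => //; last exact: integrable0.
by apply: filterS z0 => x ->; rewrite !mul0r.
Qed.

Lemma VspaceZ a v : V v -> V (a *: v).
Proof. by move=> Vv; rewrite -[a *: v]addr0; apply: VspaceD => //; exact: Vspace0. Qed.

Lemma weighted_dotC v z : weighted_dot v z = weighted_dot z v.
Proof. by apply: eq_Rintegral => x _; rewrite [v x * _]mulrC. Qed.

Lemma weighted_dotDl a u v z : V u -> V v -> V z ->
  weighted_dot (a *: u + v) z = a * weighted_dot u z + weighted_dot v z.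
Proof.
move=> Vu Vv Vz; have uz := weighted_integrable Vu Vz; have vz := weighted_integrable Vv Vz.
rewrite -RintegralZl// -RintegralD//; last first.
  exact: integrable_EFinZ.
apply: ae_eq_Rintegral => //.
  by apply: measurable_funD => //; apply: measurable_funM.
by apply: filterS (H01_funD d_gt0 bOmega a u v) => x ->; ring.
Qed.

Lemma weighted_dot_ge0 v : 0 <= weighted_dot v v.
Proof. by apply: Rintegral_ge0 => x _; exact: square_wt_ge0. Qed.

Lemma lin_formC v z : lin_form alpha y v z = lin_form alpha y z v.
Proof. by rewrite !lin_formE weighted_dotC /H01_dot sdotC. Qed.

Lemma lin_formDl a u v z : V u -> V v -> V z ->
  lin_form alpha y (a *: u + v) z = a * lin_form alpha y u z + lin_form alpha y v z.
Proof.
by move=> Vu Vv Vz; rewrite !lin_formE weighted_dotDl// /H01_dot sdotDl; ring.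
Qed.

Lemma lin_form_square a u v : V u -> V v ->
  lin_form alpha y (a *: u + v) (a *: u + v) =
  a ^+ 2 * lin_form alpha y u u + 2 * a * lin_form alpha y u v + lin_form alpha y v v.
Proof.
move=> Vu Vv; have Vuv := VspaceD a Vu Vv.
rewrite lin_formDl// ![lin_form _ _ _ (a *: u + v)]lin_formC !lin_formDl//.
by rewrite (lin_formC v u); ring.
Qed.

Lemma lin_form0l z : V z -> lin_form alpha y 0 z = 0.
Proof.
move=> Vz; have := lin_formDl (-1) Vspace0 Vspace0 Vz.
by rewrite scaler0 addr0 mulN1r addNr.
Qed.

Lemma lin_formZl a v z : V v -> V z -> lin_form alpha y (a *: v) z = a * lin_form alpha y v z.
Proof.
move=> Vv Vz; rewrite -[a *: v]addr0 lin_formDl//; last exact: Vspace0.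
by rewrite lin_form0l// addr0.
Qed.

Lemma lin_form_ge v : `|v| ^+ 2 <= lin_form alpha y v v.
Proof.
by rewrite lin_formE squot_normsq lerDl mulr_ge0 ?weighted_dot_ge0// ltW.
Qed.

(** Lower semicontinuity of the form: the gradient part converges and Fatou's lemma handles the
    weighted part. This stands in for completeness of V_y in its own norm. *)
Lemma Vspace_limit (v_ : nat -> H01) v (c_ : nat -> R) c :
  (forall n, V (v_ n)) -> v_ @ \oo --> v ->
  {ae mu, forall x, v_ n x @[n --> \oo] --> v x} ->
  (forall n, lin_form alpha y (v_ n) (v_ n) <= c_ n) -> c_ @ \oo --> c ->
  V v /\ lin_form alpha y v v <= c.
Proof.
move=> Vv_ vv vae vc cc.
have [|||||vi vle] := @fatou_ae _ _ _ mu (fun n x => v_ n x * v_ n x * wt x)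
   (fun x => v x * v x * wt x) (fun n => (c_ n - sdot (v_ n) (v_ n)) / alpha)
   ((c - sdot v v) / alpha) _ (measurable_mul_wt v v).
- by move=> n; have /VspaceP[] := Vv_ n.
- by move=> n; apply: aeW => x; exact: square_wt_ge0.
- by apply: filterS vae => x vx; apply: cvgMl; exact: cvgM.
- move=> n; rewrite ler_pdivlMr// mulrC lerBrDr addrC.
  by have := vc n; rewrite lin_formE.
- by apply: cvgMl; apply: cvgB => //; exact: squot_normsq_cvg.
split; last first.
  by rewrite lin_formE -lerBrDl mulrC -ler_pdivlMr.
apply/VspaceP; split => //.
have ae0 : {ae mu, forall x, forall n, y x = 0 -> v_ n x = 0}.
  by apply: ae_foralln => n; have /VspaceP[] := Vv_ n.
apply: filterS2 ae0 vae => x h vx yx.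
rewrite -(cvg_lim _ vx)//; under eq_fun do rewrite h//.
exact: lim_cst.
Qed.

(** The parabola is minimal at s = 0, so its slope there vanishes. Testing with -a / (b + 1) rather
    than -a / b includes b = 0. *)
Let quadratic_ge0 (a b : R) : 0 <= b -> (forall s, 0 <= s ^+ 2 * b + 2 * s * a) -> a = 0.
Proof.
move=> b0 /(_ (- a / (b + 1))) h; apply/eqP; rewrite -sqrf_eq0 eq_le sqr_ge0 andbT.
have b1 : 0 < b + 1 by lra.
have e : (- a / (b + 1)) ^+ 2 * b + 2 * (- a / (b + 1)) * a =
    - (a ^+ 2 * (b + 2)) / (b + 1) ^+ 2 by field; rewrite gt_eqF.
rewrite e pmulr_lge0 ?invr_gt0 ?exprn_gt0// oppr_ge0 pmulr_lle0// in h.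
by lra.
Qed.

(** Direct method: the minimizer over V_y of the energy [E] satisfies the variational equation.
    Since the form dominates the squared norm, [E] is bounded below by -K^2. *)
Lemma lin_form_Riesz (l : {linear H01 -> R}) K : 0 <= K ->
  (forall v, `|l v| <= K * `|v|) ->
  exists p, V p /\ forall z, V z -> lin_form alpha y p z = l z.
Proof.
move=> K0 lK; pose E v := lin_form alpha y v v - 2 * l v.
have E_ge v : - K ^+ 2 <= E v.
  have := lin_form_ge v; have := le_trans (ler_norm _) (lK v); rewrite /E.
  by have := sqr_ge0 (`|v| - K); rewrite sqrrB; lra.
pose A := [set E v | v in V]; pose m := inf A.
have infA : has_inf A.
  split; first by exists (E 0), 0 => //; exact: Vspace0.
  by exists (- K ^+ 2) => _ [v _ <-].
have m_le v : V v -> m <= E v.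
  by move=> Vv; apply: ge_inf; [case: infA|exists v].
(* With excess energy at most 4^-n, the parallelogram law and [E] >= m at the midpoint bound
   |v_(n+1) - v_n|^2 by 2 (4^-n + 4^-(n+1)) <= (2 * 2^-n)^2, whence the constant 2 below. *)
have e0 n : 0 < ((2 ^- n) ^+ 2 : R) by rewrite exprn_gt0// invr_gt0 exprn_gt0.
have /choice[v_ v_P] : forall n, exists v, V v /\ E v <= m + (2 ^- n) ^+ 2.
  move=> n; have [_ [v Vv <-] /ltW h] := inf_adherent (e0 n) infA.
  by exists v.
have Vv_ n : V (v_ n) by have [] := v_P n.
have [v [C [vC vae]]] : exists v : H01, exists C, (forall n, `|v_ n - v| <= C * 2 ^- n) /\
    {ae mu, forall x, v_ n x @[n --> \oo] --> v x}.
  apply: (@H01_complete _ _ d_gt0 _ _ bOmega _ 2) => // n.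
  rewrite -ler_sqr ?nnegrE ?mulr_ge0 ?invr_ge0 ?exprn_ge0//.
  have -> : v_ n.+1 - v_ n = -1 *: v_ n + v_ n.+1 by rewrite scaleN1r addrC.
  apply: le_trans (lin_form_ge _) _; rewrite lin_form_square//.
  pose w := 1 *: v_ n + v_ n.+1; have Vw : V w by exact: VspaceD.
  have lE : l ((1 / 2) *: w) = 1 / 2 * (l (v_ n) + l (v_ n.+1)).
    by rewrite linearZ /w scale1r linearD.
  have := m_le _ (VspaceZ (1 / 2) Vw).
  rewrite /E lin_formZl//; last exact: VspaceZ.
  rewrite lin_formC lin_formZl// lE /w lin_form_square//.
  have [_] := v_P n; have [_] := v_P n.+1; rewrite /E.
  have : ((2 ^- n.+1) ^+ 2 : R) <= (2 ^- n) ^+ 2.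
    rewrite ler_sqr ?nnegrE ?invr_ge0 ?exprn_ge0//.
    by rewrite lef_pV2 ?posrE ?exprn_gt0// ler_eXn2l// ltr1n.
  rewrite exprMn; set q := (2 ^- n) ^+ 2; set q' := (2 ^- n.+1) ^+ 2.
  lra.
have vv : v_ @ \oo --> v by exact: cvg_of_fast_dist vC.
have cl : l (v_ n) @[n --> \oo] --> l v.
  apply: (@cvg_of_fast_dist _ _ _ _ (K * C)) => n.
  by rewrite -linearB (le_trans (lK _))// -mulrA ler_wpM2l.
(* These numbers bound the form at v_n; semicontinuity then shows that the limit v attains the
   infimum. *)
have cE : m + (2 ^- n) ^+ 2 + 2 * l (v_ n) @[n --> \oo] --> m + 2 * l v.
  apply: cvgD; last by apply: cvgMr.
  rewrite -[X in _ --> X]addr0; apply: cvgD; first exact: cvg_cst.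
  have := cvg_sqr (cvg_half (1 : R)); rewrite expr0n/=.
  by under eq_cvg do rewrite mul1r.
have [Vv Ev] : V v /\ lin_form alpha y v v <= m + 2 * l v.
  apply: (@Vspace_limit v_ v _ _ Vv_ vv vae _ cE) => n.
  by rewrite -lerBlDr; have [] := v_P n.
exists v; split => // z Vz; apply/eqP; rewrite -subr_eq0; apply/eqP.
apply: (@quadratic_ge0 _ (lin_form alpha y z z)).
  by apply: le_trans (lin_form_ge z); exact: sqr_ge0.
(* Minimality along v + s z leaves a nonnegative quadratic in s whose linear coefficient is the
   residual of the equation. *)
move=> s; have := m_le _ (VspaceD s Vz Vv).
have lE : l (s *: z + v) = s * l z + l v by rewrite linearD linearZ.
rewrite /E lin_form_square// lE (lin_formC v z); move: Ev; lra.
Qed.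

End weighted_space.

(** * The derivative of the solution map *)

Section derivative_of_state.
Context (R : realType) (d : nat) (d_gt0 : (0 < d)%N).
Context (Omega : set 'rV[R]_d) (oOmega : open Omega) (bOmega : bounded_set Omega).
Context (alpha : R) (alpha_gt0 : 0 < alpha) (alpha_lt1 : alpha < 1).
Local Notation mu := (leb oOmega).
Local Notation L2 := (L2 oOmega).
Local Notation H01 := (H01 oOmega).
Local Notation spow := (@spow R alpha).

(** The rate passes to L^2 by Poincare's inequality. The almost everywhere limit from Riesz-Fischer
    is also the L^2 limit, hence equals v. *)
Lemma H01_fast_ae (v_ : nat -> H01) (v : H01) K : (forall n, `|v_ n - v| <= K * 2 ^- n) ->
  {ae mu, forall x, v_ n x @[n --> \oo] --> v x}.
Proof.
move=> vK; have [C C0 PC] := H01_L2_bounded d_gt0 oOmega bOmega.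
have K0 : 0 <= K by have := le_trans (normr_ge0 _) (vK 0%N); rewrite expr0 invr1 mulr1.
have LK n : `|H01_L2 (v_ n) - H01_L2 v| <= C * K * 2 ^- n.
  by rewrite -H01_L2B// (le_trans (PC _))// -mulrA ler_wpM2l.
have [|n|u [uC uae]] := @Riesz_Fischer _ _ _ oOmega (fun n => v_ n : L2) (2 * (C * K)).
- by rewrite !mulr_ge0.
- rewrite -[_ - _](subrKA (H01_L2 v)) (le_trans (ler_normD _ _))// [`|H01_L2 v - _|]distrC.
  have := LK n; have := LK n.+1.
  have : C * K * 2 ^- n.+1 <= C * K * 2 ^- n.
    by rewrite ler_wpM2l ?mulr_ge0// lef_pV2 ?posrE ?exprn_gt0// ler_eXn2l// ltr1n.
  lra.
have uv : u = H01_L2 v.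
  have c1 := cvg_of_fast_dist uC; have c2 := cvg_of_fast_dist LK.
  by rewrite -(cvg_lim _ c1)// -(cvg_lim _ c2).
by rewrite uv in uae.
Qed.

Lemma spow_integrable (y v : H01) : mu.-integrable setT (EFin \o (fun x => spow (y x) * v x)).
Proof.
apply: (@integrable_le_abs _ _ _ _ _ (fun x => 2 + (2 * (y x * y x) + v x * v x))).
- apply: measurable_funM; last exact: L2_measurable.
  by apply: (measurableT_comp (measurable_spow alpha_gt0)); exact: L2_measurable.
- move=> x; rewrite normrM; have := norm_spow_le alpha_gt0 alpha_lt1 (y x).
  set s := `|spow _|; set Y := `|y x|; set W := `|v x| => sY.
  have -> : y x * y x = Y ^+ 2 by rewrite real_normK ?num_real// expr2.
  have -> : v x * v x = W ^+ 2 by rewrite real_normK ?num_real// expr2.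
  have W0 : 0 <= W by exact: normr_ge0.
  apply: (@le_trans _ _ ((1 + Y) * W)); first by rewrite ler_wpM2r.
  have := sqr_ge0 (1 + Y - W); have := sqr_ge0 (1 - Y); nra.
- apply: integrable_EFinD; first exact: leb_integrable_cst.
  apply: integrable_EFinD; last exact: L2_integrable_mul.
  by apply: integrable_EFinZ; exact: L2_integrable_mul.
Qed.

(** Used with A = D_n, s the difference quotient and W twice the weight. Since A^2 <= W A s,
    multiplication by W leaves at least (A - W z)^2; if W = 0, then A = 0. *)
Let fatou_integrand_ge0 (A s W z : R) : 0 <= W -> 0 <= A * s -> `|A| <= W * `|s| ->
  0 <= A * s - 2 * (A * z) + W * (z * z).
Proof.
move=> W0 As AW.
have [W00|W_neq0] := eqVneq W 0.
  have A0 : A = 0 by apply/eqP; rewrite -normr_le0 (le_trans AW)// W00 mul0r.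
  by rewrite A0 W00 !mul0r mulr0 subr0 addr0.
have Wp : 0 < W by rewrite lt_neqAle eq_sym W_neq0.
rewrite -(pmulr_rge0 _ Wp).
have h : A ^+ 2 <= W * (A * s).
  rewrite -(ger0_norm As) normrM -real_normK ?num_real// expr2 mulrCA.
  by rewrite ler_wpM2l.
have := sqr_ge0 (A - W * z); lra.
Qed.

(** * Limits of difference quotients along a fast null sequence *)

Section difference_quotients.
Context (y delta : H01) (u h : L2) (t_ : nat -> R) (y_ : nat -> H01).
Hypothesis t_gt0 : forall n, 0 < t_ n.
Hypothesis t_small : forall n, t_ n <= 1 * 2 ^- n.
Hypothesis t_powR_small : forall n, t_ n `^ (1 - alpha) <= 1 * 2 ^- n.
Hypothesis y_sol : weak_solution alpha u y.
Hypothesis y__sol : forall n, weak_solution alpha (t_ n *: h + u) (y_ n).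
Let delta_ n : H01 := (t_ n)^-1 *: (y_ n - y).
Hypothesis delta_fast : forall n, `|delta_ n - delta| <= 1 * 2 ^- n.
Local Notation V := (Vspace alpha y).
Local Notation wt x := (weight alpha (y x)).

(** Pointwise quotient of the chosen representatives. It agrees with [delta_ n] only almost
    everywhere, but y_n = y + t_n f_n holds at every point. *)
Let f n x : R := (y_ n x - y x) / t_ n.
Let D n x : R := (spow (y_ n x) - spow (y x)) / t_ n.

Let t_neq0 n : t_ n != 0. Proof. by rewrite gt_eqF. Qed.

Let t_cvg0 : t_ @ \oo --> (0 : R).
Proof.
apply: (@cvg_of_fast_dist _ _ _ _ 1) => n.
by rewrite subr0 gtr0_norm.
Qed.

Let y_E n x : y_ n x = y x + t_ n * f n x.
Proof. by rewrite /f mulrCA divff// mulr1 addrC subrK. Qed.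

Let delta_E n : {ae mu, forall x, delta_ n x = f n x}.
Proof.
have := H01_funZ d_gt0 bOmega (t_ n)^-1 (y_ n - y); have := H01_funB d_gt0 bOmega (y_ n) y.
by apply: filterS2 => x e1 -> ; rewrite e1 mulrC.
Qed.

Let f_cvg : {ae mu, forall x, f n x @[n --> \oo] --> delta x}.
Proof.
have := H01_fast_ae delta_fast; have := ae_foralln delta_E.
by apply: filterS2 => x e; under eq_cvg do rewrite e.
Qed.

Let delta_cvg : delta_ @ \oo --> delta.
Proof. exact: cvg_of_fast_dist delta_fast. Qed.

Let measurable_f n : measurable_fun setT (f n).
Proof.
by apply: measurable_funM => //; apply: measurable_funB; exact: L2_measurable.
Qed.

Let measurable_D n : measurable_fun setT (D n).
Proof.
apply: measurable_funM => //; apply: measurable_funB;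
  by apply: (measurableT_comp (measurable_spow alpha_gt0)); exact: L2_measurable.
Qed.

Let D_mulE n (v : H01) x : D n x * v x =
  (t_ n)^-1 * (spow (y_ n x) * v x + -1 * (spow (y x) * v x)).
Proof. by rewrite /D; ring. Qed.

Let D_integrable n (v : H01) : mu.-integrable setT (EFin \o (fun x => D n x * v x)).
Proof.
under [X in _.-integrable _ X]eq_fun do rewrite /= D_mulE.
apply: integrable_EFinZ; apply: integrable_EFinD; first exact: spow_integrable.
by apply: integrable_EFinZ; exact: spow_integrable.
Qed.

(** The two state equations subtracted and divided by t_n; the common control u cancels. *)
Let D_equation n (v : H01) : \int[mu]_x (D n x * v x) = L2_dot h v - H01_dot (delta_ n) v.
Proof.
have subtract (a b p q th c : R) : a + p = th + c -> b + q = c ->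
  p + -1 * q = th - (a - b) by lra.
have i1 := spow_integrable (y_ n) v; have i2 := spow_integrable y v.
have e1 : H01_dot (y_ n) v + \int[mu]_x (spow (y_ n x) * v x) = t_ n * L2_dot h v + L2_dot u v.
  by rewrite -sdotDl; exact: y__sol.
have e2 : H01_dot y v + \int[mu]_x (spow (y x) * v x) = L2_dot u v by exact: y_sol.
under eq_Rintegral do rewrite D_mulE.
rewrite RintegralZl//; last by apply: integrable_EFinD => //; exact: integrable_EFinZ.
rewrite RintegralD//; last exact: integrable_EFinZ.
rewrite RintegralZl// /H01_dot sdotZ sdotB -/(H01_dot _ _) -/(H01_dot y _).
apply: (mulfI (t_neq0 n)); rewrite mulrA divff// mul1r mulrBr mulrA divff// mul1r.
exact: subtract e1 e2.
Qed.

Let energy n : R := L2_dot h (delta_ n) - sdot (delta_ n) (delta_ n).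
Let energy_lim : R := L2_dot h delta - sdot delta delta.

Let Df_ge0 n x : 0 <= D n x * f n x.
Proof.
rewrite /D /f mulrACA -expr2 mulr_ge0 ?sqr_ge0//; exact: spow_monotone.
Qed.

Let Df_integrable n : mu.-integrable setT (EFin \o (fun x => D n x * f n x)).
Proof.
apply: ae_eq_integrable (D_integrable n (delta_ n)); first exact: measurable_funM.
by apply: filterS (delta_E n) => x ->.
Qed.

Let Df_energy n : \int[mu]_x (D n x * f n x) = energy n.
Proof.
rewrite /energy -[sdot _ _]/(H01_dot _ _) -D_equation; apply: ae_eq_Rintegral.
- exact: measurable_funM.
- by apply: measurable_funM => //; exact: L2_measurable.
- by apply: filterS (delta_E n) => x ->.
Qed.

Let energy_cvg : energy @ \oo --> energy_lim.
Proof.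
apply: cvgB; last exact: squot_normsq_cvg.
have [C C0 PC] := H01_L2_bounded d_gt0 oOmega bOmega.
rewrite /L2_dot sdotC; under eq_cvg do rewrite sdotC; apply: sdot_cvgl.
apply: (@cvg_of_fast_dist _ _ _ _ C) => n.
by rewrite -H01_L2B// (le_trans (PC _))// ler_wpM2l// -[leRHS]mul1r.
Qed.

Let ind x : R := (y x == 0)%:R.

Let measurable_ind : measurable_fun setT ind.
Proof.
have -> : ind = \1_[set x | y x = 0].
  apply/funext => x; rewrite indicE /ind; congr (_%:R).
  by congr nat_of_bool; apply/idP/idP => [/eqP yx|/set_mem ->]; [exact: mem_set|exact: eqxx].
apply: measurable_indic.
have := L2_measurable (y : L2) measurableT (measurable_set1 0).
by rewrite setTI.
Qed.

(* Where y = 0 the quotient D_n f_n equals t_n^(alpha-1) |f_n|^(alpha+1), which can stay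
   bounded in L^1 only if f_n tends to 0 there. *)
Let delta_eq0 : {ae mu, forall x, y x = 0 -> delta x = 0}.
Proof.
pose F n x := ind x * (spow (f n x) * f n x).
have mspow g : measurable_fun setT g ->
    measurable_fun setT (fun x : 'rV[R]_d => ind x * (spow (g x) * g x)).
  move=> mg; apply: measurable_funM => //; apply: measurable_funM => //.
  exact: (measurableT_comp (measurable_spow alpha_gt0)).
have g_ge0 (a b : R) : 0 <= (a == 0)%:R * (spow b * b).
  by rewrite mulr_ge0// spow_mul mulr_ge0 ?powR_ge0.
(* An equality on {y = 0}, because g is homogeneous of degree alpha and t = t^(1-alpha) t^alpha. The
   energies converge, so the factor t_n^(1-alpha) drives the integrals to 0. *)
have FD n x : F n x <= t_ n `^ (1 - alpha) * (D n x * f n x).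
  rewrite /F /ind; case: eqP => [yx|_]; last first.
    by rewrite mul0r mulr_ge0 ?powR_ge0.
  rewrite mul1r /D y_E yx add0r spow0 subr0 spow_scale//.
  have tt : t_ n `^ (1 - alpha) * t_ n `^ alpha = t_ n.
    by rewrite -powRD ?subrK ?powRr1 ?ltW// oner_eq0.
  rewrite le_eqVlt; apply/orP; left; apply/eqP.
  rewrite -[LHS]mul1r -[X in X * _ = _](divff (t_neq0 n)) -[X in X / _]tt.
  by ring.
have Fi n : mu.-integrable setT (EFin \o F n).
  apply: integrable_le_abs (integrable_EFinZ (t_ n `^ (1 - alpha)) (Df_integrable n)).
    exact: mspow.
  by move=> x; rewrite ger0_norm ?FD// /F g_ge0.
have Fle n : \int[mu]_x F n x <= t_ n `^ (1 - alpha) * energy n.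
  rewrite -Df_energy -RintegralZl//; apply: le_Rintegral => //.
  exact: integrable_EFinZ.
have Fcvg : {ae mu, forall x, F n x @[n --> \oo] --> ind x * (spow (delta x) * delta x)}.
  by apply: filterS f_cvg => x fx; apply: cvgMr; exact: spow_mul_cvg.
have c0 : t_ n `^ (1 - alpha) * energy n @[n --> \oo] --> (0 : R).
  rewrite -(mul0r energy_lim); apply: cvgM => //.
  apply: (@cvg_of_fast_dist _ _ _ _ 1) => n.
  by rewrite subr0 ger0_norm ?powR_ge0.
have [Gi Gle] := fatou_ae Fi (mspow _ (L2_measurable (delta : L2)))
  (fun n => aeW _ (fun x => g_ge0 (y x) (f n x))) Fcvg Fle c0.
have G0 : \int[mu]_x (ind x * (spow (delta x) * delta x)) = 0.
  by apply/eqP; rewrite eq_le Gle Rintegral_ge0// => x _; exact: g_ge0.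
apply: filterS (ae_Rintegral0 Gi (fun x => g_ge0 (y x) (delta x)) G0) => x.
rewrite /ind => /[swap] ->; rewrite eqxx mul1r spow_mul => /eqP.
by rewrite mulf_eq0 powR_eq0 normr_eq0 (gt_eqF alpha_gt0) andbT orbb => /eqP.
Qed.

(** The limit form of the nonnegativity of 1_{y <> 0} D_n f_n - 2 D_n z + 2 w z^2. Taking z = 0
    gives weighted integrability of delta, and general z gives the variational inequality. *)
Let fatou_bound z : V z ->
  mu.-integrable setT (EFin \o (fun x => alpha * (delta x * delta x * wt x) +
     (- 2 * alpha * (delta x * z x * wt x) + 2 * (z x * z x * wt x)))) /\
  \int[mu]_x (alpha * (delta x * delta x * wt x) +
     (- 2 * alpha * (delta x * z x * wt x) + 2 * (z x * z x * wt x))) <=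
  energy_lim - 2 * (L2_dot h z - H01_dot delta z) + 2 * weighted_dot alpha y z z.
Proof.
move=> Vz; have /(VspaceP alpha_lt1)[zi z0] := Vz.
(* The factor 1 - [ind] removes D_n f_n on {y = 0}, where g has no derivative; the other terms
   vanish there almost everywhere, as z does. *)
pose F n x := (1 - ind x) * (D n x * f n x) + (-2 * (D n x * z x) + 2 * (z x * z x * wt x)).
have mwt := measurable_wt alpha y.
have mprod (v w : H01) : measurable_fun setT (fun x => v x * w x * wt x).
  by apply: measurable_funM => //; apply: measurable_funM; exact: L2_measurable.
have Pi n : mu.-integrable setT (EFin \o (fun x => (1 - ind x) * (D n x * f n x))).
  apply: integrable_le_abs (Df_integrable n).
    apply: measurable_funM; [exact: measurable_funB|exact: measurable_funM].
  move=> x; rewrite /ind; case: (y x == 0); rewrite ?subrr ?subr0 ?mul0r ?mul1r ?normr0//.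
  by rewrite ger0_norm.
have Fi n : mu.-integrable setT (EFin \o F n).
  apply: integrable_EFinD => //; apply: integrable_EFinD; exact: integrable_EFinZ.
apply: (fatou_ae (c_ := fun n => energy n + (-2 * (L2_dot h z - H01_dot (delta_ n) z) +
    2 * weighted_dot alpha y z z)) Fi).
- apply: measurable_funD; first exact: measurable_funM.
  by apply: measurable_funD; exact: measurable_funM.
- move=> n; apply: filterS z0 => x zx; rewrite /F /ind.
  have [yx|yx] := eqVneq (y x) 0.
    by rewrite zx// subrr !(mul0r, mulr0) !addr0.
  rewrite subr0 mul1r addrA.
  (* Twice the weight is the constant of the chord bound, which supplies |D_n| <= W |f_n|. *)
  have := @fatou_integrand_ge0 (D n x) (f n x) (2 * wt x) (z x).
  have -> : 2 * (z x * z x * wt x) = 2 * wt x * (z x * z x) by ring.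
  rewrite mulNr; apply => //; first by rewrite mulr_ge0 ?weight_ge0.
  rewrite /D /f !normrM mulrA ler_wpM2r//.
  exact: spow_lip.
- have dz0 := delta_eq0; apply: filterS3 f_cvg dz0 z0 => x fx dx zx; rewrite /F /ind.
  have [yx|yx] := eqVneq (y x) 0.
    rewrite dx// zx// !(mul0r, mulr0, addr0) subrr.
    by under eq_cvg do rewrite !(mul0r, mulr0, addr0); exact: cvg_cst.
  have Dx : D n x @[n --> \oo] --> alpha * wt x * delta x.
    rewrite /D; under eq_cvg do rewrite y_E.
    exact: spow_quotient_cvg.
  have -> : alpha * (delta x * delta x * wt x) + (-2 * alpha * (delta x * z x * wt x) +
      2 * (z x * z x * wt x)) = 1 * (alpha * wt x * delta x * delta x) +
      (- 2 * (alpha * wt x * delta x * z x) + 2 * (z x * z x * wt x)) by ring.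
  rewrite subr0; apply: cvgD; first by apply: cvgMr; exact: cvgM.
  by apply: cvgD; [apply: cvgMr; exact: cvgMl|exact: cvg_cst].
(* Restricting D_n f_n >= 0 to {y <> 0} only lowers its integral, so the energy is an upper bound;
   the term in z is computed by the quotient equation. *)
- move=> n; rewrite RintegralD//; last first.
    by apply: integrable_EFinD; exact: integrable_EFinZ.
  rewrite lerD//.
    rewrite -Df_energy; apply: le_Rintegral => // x _.
    by rewrite ler_piMl// gerBl /ind ler0n.
  rewrite RintegralD//; [|exact: integrable_EFinZ|exact: integrable_EFinZ].
  by rewrite !RintegralZl// D_equation.
- rewrite -addrA; apply: cvgD; first exact: energy_cvg.
  apply: cvgD; last exact: cvg_cst.
  rewrite -mulNr; apply: cvgMr; apply: cvgB; first exact: cvg_cst.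
  exact: sdot_cvgl.
Qed.

Lemma difference_quotient_limit :
  V delta /\ forall z, V z -> lin_form alpha y delta z = L2_dot h z.
Proof.
have V0 := Vspace0 d_gt0 bOmega alpha_lt1 y.
have mwt := measurable_wt alpha y.
have mprod (v w : H01) : measurable_fun setT (fun x => v x * w x * wt x).
  by apply: measurable_funM => //; apply: measurable_funM; exact: L2_measurable.
have zero_ae : {ae mu, forall x, (0 : H01) x = 0}.
  by have := H01_funB d_gt0 bOmega y y; rewrite subrr; apply: filterS => x ->; rewrite subrr.
have Vd : V delta.
  apply/(VspaceP alpha_lt1); split; last exact: delta_eq0.
  have := integrable_EFinZ alpha^-1 (fatou_bound V0).1.
  apply: ae_eq_integrable => //; apply: filterS zero_ae => x ->.
  by field; rewrite gt_eqF.
split => // z Vz; pose L v := lin_form alpha y delta v - L2_dot h v.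
(* The terms 2 w v^2 cancel between the two sides of the Fatou bound, leaving an inequality in which
   v enters linearly. *)
have LE v : V v -> L delta - 2 * L v <= 0.
  move=> Vv; have [_] := fatou_bound Vv.
  have dv := weighted_integrable alpha_lt1 Vd Vv; have dd := weighted_integrable alpha_lt1 Vd Vd.
  have vv := weighted_integrable alpha_lt1 Vv Vv.
  rewrite RintegralD//; last 2 first.
  - exact: integrable_EFinZ.
  - by apply: integrable_EFinD; exact: integrable_EFinZ.
  rewrite RintegralD//; last 2 first.
  - exact: integrable_EFinZ.
  - exact: integrable_EFinZ.
  rewrite !RintegralZl// -!/(weighted_dot _ _ _ _) /L !lin_formE// /energy_lim /H01_dot; lra.
apply/eqP; rewrite -subr_eq0 -/(L z); apply: contraT => Lz0.
(* Chosen so that 2 L(s z) = L(delta) - 1, which turns the inequality into 1 <= 0. *)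
pose s := (L delta - 1) / (2 * L z).
have := LE _ (VspaceZ d_gt0 bOmega alpha_lt1 s Vz).
have -> : L (s *: z) = s * L z.
  rewrite /L (lin_formC alpha_lt1) (lin_formZl d_gt0 bOmega)// (lin_formC alpha_lt1 y z).
  by rewrite /L2_dot H01_L2Z// !(sdotC h) sdotZ mulrBr.
have -> : 2 * (s * L z) = L delta - 1 by rewrite /s; field.
by rewrite opprB addrC subrK ler10.
Qed.

End difference_quotients.

End derivative_of_state.

(** Differentiability supplies strong convergence of the one-sided quotients in direction h; the
    equation of the limit then comes from the difference quotient argument. *)
Lemma state_derivative (R : realType) (d : nat) (d_gt0 : (0 < d)%N)
  (Omega : set 'rV[R]_d) (oOmega : open Omega) (bOmega : bounded_set Omega)
  (alpha : R) (alpha_gt0 : 0 < alpha) (alpha_lt1 : alpha < 1)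
  (S : L2 oOmega -> H01 oOmega) (S_sol : forall u, weak_solution alpha u (S u))
  (u h : L2 oOmega) (dS : differentiable S u) :
  Vspace alpha (S u) ('d S u h) /\
  forall z, Vspace alpha (S u) z -> lin_form alpha (S u) ('d S u h) z = L2_dot h z.
Proof.
have /cvgrPdistC_le dq : (fun t : R => t^-1 *: ((S \o shift u) (t *: h) - S u)) @ 0^'+ --> 'd S u h.
  by apply: cvg_dnbhs_at_right; rewrite -deriveE//; exact: diff_derivable.
have e0 n : 0 < (1 * 2 ^- n : R) by rewrite mul1r invr_gt0 exprn_gt0.
(* All four conditions hold for small t > 0. The bound on t^(1-alpha) serves the set {y = 0}, and
   the rate of the quotients gives almost everywhere convergence. *)
have /choice[t_ t_P] : forall n, exists t : R, [/\ 0 < t, t <= 1 * 2 ^- n,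
    t `^ (1 - alpha) <= 1 * 2 ^- n &
    `|t^-1 *: (S (t *: h + u) - S u) - 'd S u h| <= 1 * 2 ^- n].
  move=> n; have b0 : 0 < 1 - alpha by rewrite subr_gt0.
  near (0 : R)^'+ => t; exists t; split.
  - by near: t; exact: nbhs_right_gt.
  - by near: t; apply: nbhs_right_le.
  - have t0 : 0 <= t by near: t; exact: nbhs_right_ge.
    (* The third condition becomes an upper bound on t itself, with threshold
       (2^-n)^(1/(1-alpha)). *)
    have -> : 1 * 2 ^- n = (1 * 2 ^- n) `^ (1 - alpha)^-1 `^ (1 - alpha) :> R.
      by rewrite -powRrM mulVf ?gt_eqF// powRr1// ltW.
    apply: ge0_ler_powR; rewrite ?nnegrE ?powR_ge0 ?(ltW b0)//.
    by near: t; apply: nbhs_right_le; rewrite powR_gt0.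
  - by near: t; exact: (dq _ (e0 n)).
apply: (@difference_quotient_limit _ _ d_gt0 _ _ bOmega _ alpha_gt0 alpha_lt1 _ _ u h t_
  (fun n => S (t_ n *: h + u))) => // n; by have [] := t_P n.
Unshelve. all: by end_near. Qed.

(** * Equivalence of Bouligand stationarity and the KKT system *)

Theorem theorem5p3 (R : realType) (d : nat) (d_gt0 : (0 < d)%N)
  (Omega : set 'rV[R]_d) (Omega_neq0 : Omega !=set0) (oOmega : open Omega)
  (bOmega : bounded_set Omega)
  (alpha : R) (alpha_gt0 : 0 < alpha) (alpha_lt1 : alpha < 1)
  (J : H01 oOmega * L2 oOmega -> R) (dJ : forall w, differentiable J w)
  (Uad : set (L2 oOmega)) (Uad_neq0 : Uad !=set0) (cUad : convex_set Uad)
  (S : L2 oOmega -> H01 oOmega)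
  (S_sol : forall u, weak_solution alpha u (S u))
  (ubar : L2 oOmega) (dS : differentiable S ubar) :
  let ybar := S ubar in
  let dyJ := 'd (fun y => J (y, ubar)) ybar in
  let duJ := L2_riesz ('d (fun u => J (ybar, u)) ubar) in
  (Uad ubar /\
   forall u, Uad u ->
     0 <= dyJ ('d S ubar (u - ubar)) + L2_dot duJ (u - ubar))
  <->
  (exists pbar : H01 oOmega,
   [/\ Uad ubar,
       Vspace alpha ybar pbar,
       weak_solution alpha ubar ybar,
       forall z, Vspace alpha ybar z -> lin_form alpha ybar pbar z = dyJ z &
       forall u, Uad u -> 0 <= L2_dot (H01_L2 pbar + duJ) (u - ubar)]).
Proof.
move=> ybar dyJ duJ.
have deltaP h := state_derivative d_gt0 bOmega alpha_gt0 alpha_lt1 S_sol h dS.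
(* Symmetry of the form: testing the adjoint equation with S'(u)h and the equation of
   S'(u)h with the adjoint state. *)
have adjoint p h : Vspace alpha ybar p ->
    (forall z, Vspace alpha ybar z -> lin_form alpha ybar p z = dyJ z) ->
    dyJ ('d S ubar h) = L2_dot (H01_L2 p) h.
  move=> Vp eqp; have [Vd eqd] := deltaP h.
  by rewrite -eqp// (lin_formC alpha_lt1) eqd// /L2_dot sdotC.
have dotD p h : L2_dot (H01_L2 p + duJ) h = L2_dot (H01_L2 p) h + L2_dot duJ h.
  exact: sdotD.
split=> [[Uu stat]|[p [Uu Vp _ eqp stat]]]; last first.
  by split => // u Uadu; rewrite (adjoint p)// -dotD stat.
(* The derivative of J along y |-> (y, ubar) is linear and continuous, hence bounded, as the
   minimization argument for the adjoint state requires. *)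
have [K K0 dyJK] : exists2 K, 0 <= K & forall v, `|dyJ v| <= K * `|v|.
  have cdyJ : continuous dyJ.
    apply: diff_continuous; apply: (@differentiable_comp _ _ _ _ (fun y => (y, ubar)) J) => //.
  have /linear_bounded_continuous/linear_boundedP/pinfty_ex_gt0[K K0 dyJK] := cdyJ.
  by exists K => //; exact: ltW.
have [p [Vp eqp]] := lin_form_Riesz d_gt0 bOmega alpha_gt0 alpha_lt1 ybar K0 dyJK.
exists p; split => // u Uadu.
by rewrite dotD -(adjoint p)// stat.
Qed.
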